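(* Assume the standing setup below. If $\beta_n n^{-\alpha}\to\infty$ as $n\to\infty$, then $A_{(1)}\to 1$ in probability and, for every fixed integer $i\ge 2$, $A_{(i)}\to 0$ in probability.
   Context: Standing setup: Fix an integer $d\ge 2$; let $\mathbb S^{d-1}\subset\mathbb R^d$ be the unit sphere with surface measure $\sigma$. Fix $q\in\mathbb S^{d-1}$. Let $x_1,x_2,\dots$ be i.i.d. random vectors on $\mathbb S^{d-1}$ with law $\rho(x)\,d\sigma(x)$, where $\rho$ is a $C^2$ probability density on $\mathbb S^{d-1}$ with $\rho(q)>0$. Let $(\beta_n)_{n\ge1}$ be positive reals and set $\alpha=2/(d-1)$. Define $T_i=1-\langle q,x_i\rangle\in[0,2]$, $Z_n=\sum_{j=1}^n e^{-\beta_nT_j}$, attention weights $A_i=e^{-\beta_nT_i}/Z_n$ ($1\le i\le n$), and let $A_{(1)}\ge A_{(2)}\ge\cdots\ge A_{(n)}$ be their decreasing rearrangement. *)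

(* Defs.v *)
From HB Require Import structures.
From mathcomp Require Import all_boot all_order all_algebra.
From mathcomp Require Import all_classical all_reals all_analysis.
Set Implicit Arguments. Unset Strict Implicit. Unset Printing Implicit Defensive.
Import Order.TTheory GRing.Theory Num.Theory.
Import numFieldNormedType.Exports.
Local Open Scope classical_set_scope.
Local Open Scope ring_scope.

Section Defs.
Variable R : realType.

Definition inner (d : nat) (u v : 'rV[R]_d) : R := \sum_(i < d) u 0 i * v 0 i.
Definition enorm (d : nat) (v : 'rV[R]_d) : R := Num.sqrt (inner v v).
Definition sphere (d : nat) : set 'rV[R]_d := [set v | inner v v = 1].
Definition normalize (d : nat) (y : 'rV[R]_d) : 'rV[R]_d := (enorm y)^-1 *: y.

Definition borel_vec (d : nat) : set (set 'rV[R]_d) := <<s [set A | open A] >>.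

(** Lebesgue integral on R^d of a nonnegative function, computed as an
    iterated one-dimensional Lebesgue integral over the coordinates
    (equal to the d-dimensional Lebesgue integral by Tonelli). *)
Fixpoint iter_int (n : nat) : ((nat -> R) -> \bar R) -> \bar R :=
  match n with
  | 0%N => fun g => g (fun _ => 0)
  | n'.+1 => fun g =>
      (\int[@lebesgue_measure R]_t
         iter_int n' (fun y => g (fun k => if k == n' then t else y k)))%E
  end.
Definition lebesgue_int_Rd (d : nat) (G : 'rV[R]_d -> \bar R) : \bar R :=
  iter_int d (fun y => G (\row_(j < d) y (nat_of_ord j))).

(** Integral over A (a subset of the sphere) of f against the surface measure
    sigma on S^{d-1}, with sigma the cone measure:
    sigma(A) = d * Leb({t x | x in A, 0 < t <= 1}). *)
Definition sphere_int (d : nat) (f : 'rV[R]_d -> R) (A : set 'rV[R]_d)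
  : \bar R :=
  (d%:R%:E * lebesgue_int_Rd (fun y =>
     (\1_[set z | 0 < enorm z <= 1 /\ A (normalize z)] y)%:E
       * (f (normalize y))%:E))%E.

Definition evec (d : nat) (i : 'I_d) : 'rV[R]_d := delta_mx 0 i.

Definition C2_on (d : nat) (U : set 'rV[R]_d) (f : 'rV[R]_d -> R) : Prop :=
  open U /\
  (forall x, U x -> {for x, continuous f}) /\
  (forall (i : 'I_d) x, U x -> derivable f x (evec i)) /\
  (forall (i : 'I_d) x, U x -> {for x, continuous ('D_(evec i) f)}) /\
  (forall (i j : 'I_d) x, U x -> derivable ('D_(evec i) f) x (evec j)) /\
  (forall (i j : 'I_d) x, U x ->
     {for x, continuous ('D_(evec j) ('D_(evec i) f))}).

(** A function rho on S^{d-1} is C^2 iff its 0-homogeneous extension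
    y |-> rho (y / |y|) is C^2 on R^d \ {0}. *)
Definition C2_on_sphere (d : nat) (rho : 'rV[R]_d -> R) : Prop :=
  C2_on [set y | y != 0] (fun y => rho (normalize y)).

(** Attention-model quantities, with samples x 0, ..., x (n-1)
    (the paper's x_1, ..., x_n). *)
Definition Tval (d : nat) (q x : 'rV[R]_d) : R := 1 - inner q x.
Definition Zn (d : nat) {Omega : Type} (beta : nat -> R) (q : 'rV[R]_d)
  (x : nat -> Omega -> 'rV[R]_d) (n : nat) (w : Omega) : R :=
  \sum_(j < n) expR (- beta n * Tval q (x j w)).
Definition attn (d : nat) {Omega : Type} (beta : nat -> R) (q : 'rV[R]_d)
  (x : nat -> Omega -> 'rV[R]_d) (n i : nat) (w : Omega) : R :=
  expR (- beta n * Tval q (x i w)) / Zn beta q x n w.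
(** Order statistics: A_(i), i >= 1, is the i-th largest of A_1..A_n
    (set to 0 when i = 0 or i > n, irrelevant for the limits). *)
Definition attn_ord (d : nat) {Omega : Type} (beta : nat -> R)
  (q : 'rV[R]_d) (x : nat -> Omega -> 'rV[R]_d) (n i : nat) (w : Omega) : R :=
  if i == 0%N then 0 else
  nth 0 (sort (fun a b : R => b <= a)
               [seq attn beta q x n j w | j <- iota 0 n]) i.-1.

Definition mutually_independent {dO : measure_display} {Omega : measurableType dO}
  (P : probability Omega R) (d : nat) (x : nat -> Omega -> 'rV[R]_d) : Prop :=
  forall (s : seq nat) (B : nat -> set 'rV[R]_d),
    uniq s -> (forall i, borel_vec (B i)) ->
    P (\bigcap_(i in [set` s]) (x i @^-1` B i)) =
    (\prod_(i <- s) P (x i @^-1` B i))%E.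

Definition cvg_in_prob {dO : measure_display} {Omega : measurableType dO}
  (P : probability Omega R) (Y : nat -> Omega -> R) (c : R) : Prop :=
  forall eps : R, 0 < eps ->
    (fun n => P [set w | eps <= `|Y n w - c|]) @ \oo --> 0%E.

End Defs.
Arguments sphere {R} d.

(* Main.v *)
Require Import Defs.
From HB Require Import structures.
From mathcomp Require Import all_boot all_order all_algebra.
From mathcomp Require Import all_classical all_reals all_analysis.
From mathcomp Require Import measurable_realfun ring lra.
Import Order.TTheory GRing.Theory Num.Theory.
Import numFieldNormedType.Exports.
Local Open Scope classical_set_scope.
Local Open Scope ring_scope.

(* The sphere measure is a cone measure, so P(a <= T < b) is comparable to the
   Lebesgue measure of a set of y in the ball with y / |y| near q.  Let k be the last coordinate with
   q_k <> 0.  For y in the cone { T <= b }, each other coordinate y_j lies within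
   O(sqrt b) of y_k q_j / q_k, which is 0 if j > k, so that the centre depends only on
   coordinates integrated outside y_j, and the condition a <= T <= b confines y_0 to the set where a
   quadratic polynomial takes values in an interval of length 2(b - a).  This gives
     P(a <= T < b) <= C sqrt(b)^(d-2) sqrt(b - a),   P(T < t) >= c sqrt(t)^(d-1)
   for small b, t.  Put r = n^(-alpha), so that n sqrt(r)^(d-1) = 1.  With
   probability close to 1, some T_i is below K r; no T_j lies within h = K r / N of
   such a T_i (independence, and a partition into cells of length h); and the sum
   over T_j >= h of (h / T_j)^(d+1) stays bounded (Markov).  The gap from the
   minimum T_i to any other T_j is then at least T_j / 2N, and exp(-y) <= M! / y^M
   makes the total weight of the other points O((beta r)^(-(d+1))) -> 0. *)

(** * Monotonicity of integrals, and integrals of scaled indicators *)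

Section IntegralBasics.
Context {dT : measure_display} {T : measurableType dT} {R : realType}.
Variable mu : {measure set T -> \bar R}.

(* The integral of a nonnegative function is a supremum over simple functions below
   it, so monotonicity needs no measurability; the partial integrals inside
   [iter_int] therefore never have to be shown measurable. *)
Lemma ge0_le_integral_nomeas (f1 f2 : T -> \bar R) :
  (forall t, 0 <= f1 t)%E -> (forall t, f1 t <= f2 t)%E ->
  (\int[mu]_t f1 t <= \int[mu]_t f2 t)%E.
Proof.
move=> f10 f12.
have f20 t : (0 <= f2 t)%E by exact: le_trans (f12 t).
rewrite !ge0_integralTE//; apply: ub_ereal_sup => _ /= [h hf1 <-].
by apply: ereal_sup_ubound; exists h => // t; exact: le_trans (f12 t).
Qed.

Lemma integral_scale_indic (M : R) (A : set T) : 0 <= M -> measurable A ->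
  (\int[mu]_t (M * \1_A t)%:E = M%:E * mu A)%E.
Proof.
move=> M0 mA; under eq_integral do rewrite EFinM.
rewrite ge0_integralZl ?lee_fin//; first by rewrite integral_indic// setIT.
exact/measurable_EFinP/measurable_indic.
Qed.

End IntegralBasics.

(** * Iterated integrals *)

Section IteratedIntegral.
Context {R : realType}.
Local Notation mu := (@lebesgue_measure R).
Implicit Types (o : nat -> R) (g : (nat -> R) -> \bar R).

Definition upd o (n : nat) (t : R) : nat -> R :=
  fun k => if k == n then t else o k.

Definition splice (n : nat) (y o : nat -> R) : nat -> R :=
  fun k => if (k < n)%N then y k else o k.

(* [iter_int] with the values of the outer coordinates (indices [>= n]) kept in [o]. *)
Fixpoint iter_int_from (n : nat) g o : \bar R :=
  match n with
  | 0%N => g o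
  | n'.+1 => (\int[mu]_t iter_int_from n' g (upd o n' t))%E
  end.

(** Moves the coordinates fixed by the outer integrals out of the integrand and into [o]: fixing
    coordinate n of the integration variable at t amounts to splicing with [upd o n t]. *)
Lemma iter_int_splice n g o :
  iter_int n (fun y => g (splice n y o)) = iter_int_from n g o.
Proof.
elim: n o => [|n IH] o; first by rewrite /=; congr g; exact/funext.
rewrite /=; congr integral; apply/funext => t.
rewrite -IH; congr iter_int; apply/funext => y; congr g; apply/funext => k.
rewrite /splice /upd ltnS leq_eqVlt; case: eqVneq => [->|kn] /=; last by [].
by rewrite ltnn.
Qed.

(** Constrains only the coordinates already fixed while the [n] inner integrals remain: [upto d 0 S]
    is the whole region and [upto d d S] is no condition. *)
Definition upto (d n : nat) (S : nat -> (nat -> R) -> set R) : set (nat -> R) :=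
  [set y | forall j, (n <= j < d)%N -> S j y (y j)].

(* The slice [S j] of coordinate [j] may depend only on the coordinates integrated
   outside it, i.e. those of larger index. *)
Variables (d : nat) (S : nat -> (nat -> R) -> set R).
Hypothesis Souter : forall j y y',
  (forall k, (j < k)%N -> y k = y' k) -> S j y = S j y'.
Hypothesis mS : forall j y, measurable (S j y).

(** By [Souter], no slice of index at least [n] looks at coordinate [n], so assigning it changes
    neither [S n] nor the outer slices. *)
Lemma upto_upd n o t : (n < d)%N ->
  upto d n S (upd o n t) <-> upto d n.+1 S o /\ S n o t.
Proof.
move=> nd; have Sn : S n (upd o n t) = S n o.
  by apply: Souter => k nk; rewrite /upd gtn_eqF.
have Sj j : (n < j)%N -> S j (upd o n t) = S j o.
  by move=> nj; apply: Souter => k jk; rewrite /upd gtn_eqF// (ltn_trans nj).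
split=> [H|[H Ht]].
  split=> [j /andP[nj jd]|]; last first.
    by have := H n; rewrite leqnn nd Sn /upd eqxx => /(_ isT).
  by have := H j; rewrite (ltnW nj) jd Sj// /upd gtn_eqF// => /(_ isT).
move=> j /andP[]; rewrite leq_eqVlt => /predU1P[<- _|nj jd].
  by rewrite Sn /upd eqxx.
by rewrite Sj// /upd gtn_eqF//; apply: H; rewrite nj.
Qed.

Lemma indic_upto n o t : (n < d)%N ->
  \1_(upto d n S) (upd o n t) = \1_(upto d n.+1 S) o * \1_(S n o) t :> R.
Proof.
move=> nd; rewrite !indicE -natrM mulnb; congr (_%:R).
have [/set_mem/(upto_upd n o t nd) [h1 h2]|h] :=
  boolP (upd o n t \in upto d n S).
  by rewrite !mem_set.
case: (boolP (o \in _)) => //= /set_mem ho; case: (boolP (t \in _)) => //= /set_mem ht.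
by exfalso; move/negP: h; apply; apply/mem_set/upto_upd.
Qed.

Lemma iter_int_from_ge0 n g o :
  (forall y, 0 <= g y)%E -> (0 <= iter_int_from n g o)%E.
Proof.
by move=> g0; elim: n o => [|n IH] o //=; apply: integral_ge0 => t _; exact: IH.
Qed.

(** Tonelli by hand: by [indic_upto], each integration turns the indicator of the region into that
    of the outer region times the measure of one slice, at most [l n]. *)
Lemma iter_int_from_le (l : nat -> R) (M : R) g n o :
  (forall j y, (j < d)%N -> (mu (S j y) <= (l j)%:E)%E) -> 0 <= M ->
  (forall j, (j < d)%N -> 0 <= l j) ->
  (forall y, 0 <= g y)%E ->
  (forall y, g y <= (M * \1_(upto d 0 S) y)%:E)%E -> (n <= d)%N ->
  (iter_int_from n g o <=
     (M * \prod_(j < n) l j * \1_(upto d n S) o)%:E)%E.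
Proof.
move=> Sl M0 l0 g0 gM; elim: n o => [|n IH] o nd; first by rewrite big_ord0 mulr1.
have c0 : 0 <= M * \prod_(j < n) l j * \1_(upto d n.+1 S) o.
  rewrite mulr_ge0// mulr_ge0// prodr_ge0// => i _.
  by apply: l0; exact: ltn_trans nd.
rewrite /=; apply: le_trans.
  apply: ge0_le_integral_nomeas => [t|t]; first exact: iter_int_from_ge0.
  exact: (IH _ (ltnW nd)).
under eq_integral do rewrite indic_upto// mulrA.
rewrite integral_scale_indic; [|exact: c0|exact: mS].
rewrite big_ord_recr/= mulrA (mulrAC _ (l n)) [X in (_ <= X)%E]EFinM.
by apply: lee_pmul; rewrite ?lee_fin//; exact: Sl.
Qed.

Lemma iter_int_from_ge (l : nat -> R) (M : R) g n o :
  (forall j y, (j < d)%N -> ((l j)%:E <= mu (S j y))%E) -> 0 <= M ->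
  (forall j, (j < d)%N -> 0 <= l j) ->
  (forall y, (M * \1_(upto d 0 S) y)%:E <= g y)%E -> (n <= d)%N ->
  ((M * \prod_(j < n) l j * \1_(upto d n S) o)%:E <= iter_int_from n g o)%E.
Proof.
move=> Sl M0 l0 gM; elim: n o => [|n IH] o nd; first by rewrite big_ord0 mulr1.
have p0 : 0 <= M * \prod_(j < n) l j.
  rewrite mulr_ge0// prodr_ge0// => i _.
  by apply: l0; exact: ltn_trans nd.
rewrite /=; apply: le_trans; last first.
  apply: ge0_le_integral_nomeas => [t|t]; last exact: (IH _ (ltnW nd)).
  by rewrite lee_fin mulr_ge0.
under eq_integral do rewrite indic_upto// mulrA.
rewrite integral_scale_indic; [|exact: mulr_ge0|exact: mS].
rewrite big_ord_recr/= mulrA (mulrAC _ (l n)) [X in (X <= _)%E]EFinM.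
by apply: lee_pmul; [rewrite lee_fin mulr_ge0 | rewrite lee_fin l0 | | exact: Sl].
Qed.

End IteratedIntegral.

(** * Geometry of thin cones *)

Section Inner.
Context {R : realType} {d : nat}.
Implicit Types (u v w y z q : 'rV[R]_d).

Lemma innerC u v : inner u v = inner v u.
Proof. by apply: eq_bigr => i _; rewrite mulrC. Qed.

Lemma innerDl u v w : inner (u + v) w = inner u w + inner v w.
Proof.
by rewrite /inner -big_split; apply: eq_bigr => i _; rewrite mxE mulrDl.
Qed.

Lemma innerZl (a : R) u v : inner (a *: u) v = a * inner u v.
Proof.
by rewrite /inner big_distrr; apply: eq_bigr => i _; rewrite mxE -mulrA.
Qed.

Lemma innerDr u v w : inner u (v + w) = inner u v + inner u w.
Proof. by rewrite innerC innerDl !(innerC u). Qed.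

Lemma innerZr (a : R) u v : inner u (a *: v) = a * inner u v.
Proof. by rewrite innerC innerZl innerC. Qed.

Lemma inner_ge0 u : 0 <= inner u u.
Proof. by apply: sumr_ge0 => i _; rewrite -expr2 sqr_ge0. Qed.

Lemma sqr_coord_le_inner u i : u 0 i ^+ 2 <= inner u u.
Proof.
rewrite /inner (bigD1 i)//= -expr2 lerDl.
by apply: sumr_ge0 => j _; rewrite -expr2 sqr_ge0.
Qed.

(** Pythagoras: [inner q y *: q] is the orthogonal projection of [y] on the line of the unit vector
    [q]. *)
Lemma inner_orth q y : sphere d q ->
  inner (y - inner q y *: q) (y - inner q y *: q) = inner y y - inner q y ^+ 2.
Proof.
rewrite /sphere /= => qq.
rewrite -scaleNr innerDl !innerDr !innerZl !innerZr qq (innerC y q); ring.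
Qed.

Lemma sqr_inner_le q y : sphere d q -> inner q y ^+ 2 <= inner y y.
Proof. by move=> qS; rewrite -subr_ge0 -inner_orth// inner_ge0. Qed.

Lemma sqr_enorm y : enorm y ^+ 2 = inner y y.
Proof. by rewrite /enorm sqr_sqrtr// inner_ge0. Qed.

Lemma sphere_normalize y : 0 < enorm y -> sphere d (normalize y).
Proof.
move=> y0; rewrite /sphere /= /normalize innerZl innerZr -sqr_enorm.
by field; rewrite gt_eqF.
Qed.

Lemma normalize_sphere y : sphere d y -> normalize y = y.
Proof.
by rewrite /sphere /= /normalize /enorm => ->; rewrite sqrtr1 invr1 scale1r.
Qed.

Lemma Tval_normalize q y : Tval q (normalize y) = 1 - inner q y / enorm y.
Proof. by rewrite /Tval /normalize innerZr mulrC. Qed.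

Lemma Tval_ge0 q y : sphere d q -> sphere d y -> 0 <= Tval q y.
Proof.
move=> qS yS; have := sqr_inner_le q y qS; rewrite (_ : inner y y = 1)//.
by rewrite /Tval => h; rewrite subr_ge0; nra.
Qed.

Lemma Tval_le2 q y : sphere d q -> sphere d y -> Tval q y <= 2.
Proof.
move=> qS yS; have := sqr_inner_le q y qS; rewrite (_ : inner y y = 1)//.
by rewrite /Tval => h; nra.
Qed.

Lemma inner_sub_sphere q y : sphere d q -> sphere d y ->
  inner (y - q) (y - q) = 2 * Tval q y.
Proof.
rewrite /sphere /Tval /= => qq yy.
rewrite -scaleN1r innerDl !innerDr !innerZl !innerZr qq yy (innerC y q); ring.
Qed.

(** With u = <q,y>/|y| the cell condition reads 1 - b <= u <= 1 - a. Hence 1 - u^2 <= 2b and 0 <=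
    u^2 - (1-b)^2 <= 2(b-a); multiplying by |y|^2 <= 1 gives conditions polynomial in [y]. *)
Lemma cone_cell_bounds q y (a b : R) : sphere d q -> 0 <= a -> a <= b -> b <= 1 ->
  0 < enorm y <= 1 -> a <= Tval q (normalize y) <= b ->
  [/\ inner y y <= 1, inner y y - inner q y ^+ 2 <= 2 * b &
      0 <= inner q y ^+ 2 - (1 - b) ^+ 2 * inner y y <= 2 * (b - a)].
Proof.
move=> qS a0 ab b1 /andP[e0 e1]; rewrite Tval_normalize => /andP[h1 h2].
have -> : inner q y = (inner q y / enorm y) * enorm y.
  by rewrite divfK// gt_eqF.
rewrite -sqr_enorm; set e := enorm y in e0 e1 h1 h2 *.
move: h1 h2; set u := inner q y / e => h1 h2.
have e21 : e ^+ 2 <= 1 by nra.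
have e20 : 0 <= e ^+ 2 by rewrite sqr_ge0.
rewrite exprMn; move: e21 e20; set E := e ^+ 2 => e21 e20.
have v0 : 0 <= 1 - u ^+ 2 <= 2 * b by apply/andP; split; nra.
have v1 : 0 <= u ^+ 2 - (1 - b) ^+ 2 <= 2 * (b - a).
  have : u ^+ 2 <= (1 - a) ^+ 2 by nra.
  have : (1 - b) ^+ 2 <= u ^+ 2 by nra.
  by move=> *; apply/andP; split; nra.
case/andP: v0 => v0 v0'; case/andP: v1 => v1 v1'.
split => //; first by nra.
by apply/andP; split; nra.
Qed.

(** The component of [y] along [q] cancels in y_i q_j - y_j q_i. What is left involves the
    orthogonal part [z], whose coordinates are at most sqrt(2b) in absolute value. *)
Lemma coord_window q y i j (b : R) : sphere d q ->
  inner y y - inner q y ^+ 2 <= 2 * b ->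
  `|y 0 i * q 0 j - y 0 j * q 0 i| <= 2 * Num.sqrt (2 * b).
Proof.
move=> qS; rewrite -inner_orth//; set z := y - _ => zb.
have qc l : `|q 0 l| <= 1.
  have := sqr_coord_le_inner q l; rewrite (_ : inner q q = 1)// => h.
  by rewrite ler_norml; apply/andP; split; nra.
have zc l : `|z 0 l| <= Num.sqrt (2 * b).
  by rewrite -sqrtr_sqr ler_wsqrtr// (le_trans (sqr_coord_le_inner _ _)).
have -> : y 0 i * q 0 j - y 0 j * q 0 i = z 0 i * q 0 j - z 0 j * q 0 i.
  rewrite /z !mxE; ring.
rewrite (le_trans (ler_normB _ _))// !normrM mulr_natl mulr2n.
by rewrite lerD// -[leRHS]mulr1 ler_pM.
Qed.

End Inner.

(** * Quadratic slabs on the real line *)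

Section LineMeasure.
Context {R : realType}.
Local Notation mu := (@lebesgue_measure R).

Lemma measure_itvcc (a b : R) : a <= b ->
  mu `[a, b]%classic = (b - a)%:E.
Proof.
move=> ab; rewrite lebesgue_measure_itv /= lte_fin.
by case: ltgtP ab => // -> _; rewrite subrr.
Qed.

Lemma measure_ball_itv (c w : R) : 0 <= w ->
  mu `[c - w, c + w]%classic = (2 * w)%:E.
Proof. by move=> w0; rewrite measure_itvcc; [congr (_%:E); ring|rewrite lerD2l; lra]. Qed.

Lemma measurable_quadratic_slab (A B C e : R) :
  measurable [set s : R | 0 <= A * s ^+ 2 + B * s + C <= e].
Proof.
have mf : measurable_fun setT (fun s : R => A * s ^+ 2 + B * s + C).
  apply: measurable_funD => //; apply: measurable_funD.
    by apply: measurable_funM => //; exact: exprn_measurable.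
  by apply: measurable_funM.
rewrite (_ : [set _ | _] = (fun s : R => A * s ^+ 2 + B * s + C) @^-1` `[0, e]).
  by rewrite -[X in measurable X]setTI; apply: mf => //; exact: measurable_itv.
by apply/seteqP; split => s /=; rewrite in_itv.
Qed.

Lemma quadratic_slab_sqr (A B C e : R) : A != 0 -> 0 <= e ->
  exists E : R, forall s, 0 <= A * s ^+ 2 + B * s + C <= e ->
    E <= (s + B / (2 * A)) ^+ 2 <= E + e / `|A|.
Proof.
move=> A0 e0; pose x s := s + B / (2 * A).
have completion s :
    A * s ^+ 2 + B * s + C = A * x s ^+ 2 + (C - B ^+ 2 / (4 * A)).
  by rewrite /x; field.
set C' := C - B ^+ 2 / (4 * A) in completion.
have [An|Ap] := ltP A 0.
- exists ((C' - e) / - A) => s; rewrite completion ltr0_norm// -/(x s).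
  have An' : 0 < - A by rewrite oppr_gt0.
  rewrite -mulrDl ler_pdivrMr// ler_pdivlMr// => /andP[h1 h2].
  by apply/andP; split; lra.
- have Ap' : 0 < A by rewrite lt_neqAle eq_sym A0.
  exists (- C' / A) => s; rewrite completion ger0_norm// -/(x s).
  rewrite -mulrDl ler_pdivrMr// ler_pdivlMr// => /andP[h1 h2].
  by apply/andP; split; lra.
Qed.

(** After completing the square, |s + s0| lies in [a, a + r] with a = sqrt(max(0, E)), because E +
    r^2 <= (a + r)^2. These are two intervals of length r, whatever E is. *)
Lemma measure_quadratic_slab (A B C e : R) : A != 0 -> 0 <= e ->
  (mu [set s | 0 <= A * s ^+ 2 + B * s + C <= e]%R
     <= (2 * Num.sqrt (e / `|A|))%:E)%E.
Proof.
move=> A0 e0; have [E HE] := quadratic_slab_sqr A B C e A0 e0.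
set s0 := B / (2 * A) in HE; set r := Num.sqrt (e / `|A|).
have r0 : 0 <= r by exact: sqrtr_ge0.
have rr : r ^+ 2 = e / `|A| by rewrite sqr_sqrtr// divr_ge0.
pose a := Num.sqrt (Num.max 0 E).
have a0 : 0 <= a by exact: sqrtr_ge0.
have aa : a ^+ 2 = Num.max 0 E by rewrite sqr_sqrtr// le_max lexx.
pose I1 := `[- s0 + a, - s0 + a + r]%classic : set R.
pose I2 := `[- s0 - a - r, - s0 - a]%classic : set R.
have sub : [set s | 0 <= A * s ^+ 2 + B * s + C <= e] `<=` I1 `|` I2.
  move=> s /= /HE /andP[]; rewrite -rr => h1 h2.
  have g1 : a ^+ 2 <= (s + s0) ^+ 2 by rewrite aa ge_max sqr_ge0.
  have g2 : (s + s0) ^+ 2 <= (a + r) ^+ 2.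
    have : E <= a ^+ 2 by rewrite aa le_max lexx orbT.
    by nra.
  have [sp|sn] := leP 0 (s + s0).
    by left; rewrite /I1 /= in_itv /=; apply/andP; split; nra.
  by right; rewrite /I2 /= in_itv /=; apply/andP; split; nra.
apply: (@le_trans _ _ (mu (I1 `|` I2))).
  apply: le_measure => //; rewrite inE; first exact: measurable_quadratic_slab.
  by apply: measurableU; exact: measurable_itv.
apply: (le_trans (measureU2 _ _ _)); [exact: measurable_itv..|].
have -> : (2 * r)%:E = (mu I1 + mu I2)%E.
  by rewrite /I1 /I2 !measure_itvcc; [rewrite -EFinD; congr EFin; ring|lra..].
exact: lexx.
Qed.

End LineMeasure.

(** * Slicing cells and caps coordinate by coordinate *)

Section ConeEstimates.
Context {R : realType} {m : nat}.
Local Notation mu := (@lebesgue_measure R).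
Local Notation vec := 'rV[R]_m.+2.
Implicit Types (q v : vec) (rho : vec -> R) (y o : nat -> R).

Definition vec_of y : vec := \row_(j < m.+2) y (nat_of_ord j).

Lemma vec_ofE y j : vec_of y 0 j = y j.
Proof. by rewrite mxE. Qed.

Definition cone_integrand (f : vec -> R) (A : set vec) y : \bar R :=
  ((\1_[set z | 0 < enorm z <= 1 /\ A (normalize z)] (vec_of y))%:E
    * (f (normalize (vec_of y)))%:E)%E.

Lemma sphere_int_from (f : vec -> R) (A : set vec) :
  sphere_int f A =
  ((m.+2)%:R%:E * iter_int_from m.+2 (cone_integrand f A) (fun=> 0%R))%E.
Proof.
rewrite /sphere_int /lebesgue_int_Rd; congr (_ * _)%E.
rewrite -iter_int_splice; congr iter_int; apply/funext => y.
rewrite /cone_integrand (_ : vec_of (splice _ _ _) = vec_of y)//.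
by apply/rowP => j; rewrite !mxE /splice ltn_ord.
Qed.

Lemma near_sphere_continuous q rho : sphere m.+2 q ->
  {for q, continuous (fun v => rho (normalize v))} -> 0 < rho q ->
  exists2 b : R, 0 < b & forall v, sphere m.+2 v -> Tval q v <= b ->
    rho q / 2 <= rho v <= 2 * rho q.
Proof.
move=> qS /cvgrPdist_le/(_ (rho q / 2)) cont rq.
have /cont /nbhs_ballP[e /= e0 be] : 0 < rho q / 2 by rewrite divr_gt0.
(* Since |v - q|^2 = 2T, this radius keeps each coordinate of v - q within e/2, and the ball is
   coordinatewise. *)
exists (e ^+ 2 / 8); first by rewrite divr_gt0// exprn_gt0.
move=> v vS vb.
have /be : ball q e v.
  split=> // i j; rewrite (ord1 i) /ball /= -opprB normrN.
  have := sqr_coord_le_inner (v - q) j; rewrite inner_sub_sphere// !mxE => h.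
  by rewrite ltr_norml; apply/andP; split; nra.
rewrite /= !normalize_sphere// ler_norml => /andP[h1 h2].
by apply/andP; split; lra.
Qed.

Lemma last_nonzero_coord q : sphere m.+2 q ->
  exists2 k : 'I_m.+2, q 0 k != 0 & forall j : 'I_m.+2, (k < j)%N -> q 0 j = 0.
Proof.
move=> qS; have [i0 qi0] : exists i, q 0 i != 0.
  apply/existsP; apply: contraT; rewrite negb_exists => /forallP q0.
  have : inner q q = 0.
    by apply: big1 => i _; move/negPn/eqP: (q0 i) => ->; rewrite mul0r.
  by move=> qq; move: qS; rewrite /sphere /= qq => /eqP; rewrite eq_sym oner_eq0.
case: (@arg_maxnP _ i0 (fun i => q 0 i != 0) (fun i => nat_of_ord i) qi0) => k qk kmax.
exists k => // j kj; apply/eqP; apply: contraLR kj => /kmax.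
by rewrite -leqNgt.
Qed.

Section Geometry.
Variables (q : vec) (k : 'I_m.+2).
Hypothesis qS : sphere m.+2 q.
Hypothesis qk0 : q 0 k != 0.
Hypothesis qk : forall j : 'I_m.+2, (k < j)%N -> q 0 j = 0.

(** The j-th coordinate of the point of the line R q whose k-th coordinate is [y k]. For j > k it
    vanishes by [qk]; the explicit test makes it independent of inner coordinates. *)
Definition axis_center (j : nat) y : R :=
  if (j < k)%N then y k * q 0 (inord j) / q 0 k else 0.

Lemma axis_centerE (j : 'I_m.+2) y : j != k ->
  axis_center j y = y k * q 0 j / q 0 k.
Proof.
rewrite /axis_center inord_val => jk; case: ltnP => // kj.
by rewrite qk ?mulr0 ?mul0r// ltn_neqAle kj eq_sym jk.
Qed.

Lemma axis_center_outer j y y' : (forall i, (j < i)%N -> y i = y' i) ->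
  axis_center j y = axis_center j y'.
Proof. by rewrite /axis_center => h; case: ifP => // /h ->. Qed.

Let q0 := q 0 ord0.
(** With s the coordinate 0 of y, <q,y> = q0 s + Lout and |y|^2 = s^2 + Nout. The quadratic in s
    used for slice 0 below is thus <q,y>^2 - (1-b)^2 |y|^2. *)
Let Lout y := \sum_(i < m.+1) q 0 (lift ord0 i) * y i.+1.
Let Nout y := \sum_(i < m.+1) y i.+1 * y i.+1.

(* Slice 0 must come first: when [k = 0] (that is, q = +-e_0) the quadratic condition,
   whose leading coefficient is then of order b, is the one that is needed. *)
Definition cell_slices (a b w : R) (j : nat) y : set R :=
  if j == 0%N then
    [set s | 0 <= (q0 ^+ 2 - (1 - b) ^+ 2) * s ^+ 2 + (2 * q0 * Lout y) * s
                  + (Lout y ^+ 2 - (1 - b) ^+ 2 * Nout y) <= 2 * (b - a)]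
  else if j == k then `[0 - 1, 0 + 1]%classic
  else `[axis_center j y - w, axis_center j y + w]%classic.

Lemma cell_slices_outer a b w j y y' :
  (forall i, (j < i)%N -> y i = y' i) ->
  cell_slices a b w j y = cell_slices a b w j y'.
Proof.
move=> h; rewrite /cell_slices; case: eqP => [j0|_].
  have -> : Lout y = Lout y'.
    by apply: eq_bigr => i _; rewrite h// j0.
  have -> : Nout y = Nout y'.
    by apply: eq_bigr => i _; rewrite h// j0.
  by [].
by case: ifP => // _; rewrite (axis_center_outer _ _ _ h).
Qed.

Lemma measurable_cell_slices a b w j y : measurable (cell_slices a b w j y).
Proof.
rewrite /cell_slices; case: eqP => _; first exact: measurable_quadratic_slab.
by case: ifP => _; exact: measurable_itv.
Qed.

Definition cell_bound (a b w : R) (j : nat) : R :=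
  if j == 0%N then
    2 * Num.sqrt (2 * (b - a) / `|q0 ^+ 2 - (1 - b) ^+ 2|)
  else if j == k then 2 * 1 else 2 * w.

Lemma measure_cell_slices a b w j y : q0 ^+ 2 - (1 - b) ^+ 2 != 0 ->
  a <= b -> 0 <= w ->
  (mu (cell_slices a b w j y) <= (cell_bound a b w j)%:E)%E.
Proof.
move=> A0 ab w0; rewrite /cell_slices /cell_bound; case: eqP => _.
  by apply: measure_quadratic_slab => //; lra.
by case: ifP => _; rewrite measure_ball_itv.
Qed.

Lemma cell_in_slices a b y : 0 <= a -> a <= b -> b <= 1 ->
  0 < enorm (vec_of y) <= 1 -> a <= Tval q (normalize (vec_of y)) <= b ->
  upto m.+2 0 (cell_slices a b (2 * Num.sqrt (2 * b) / `|q 0 k|)) y.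
Proof.
move=> a0 ab b1 ye yT.
have [N1 Nb /andP[Q0 Q1]] := cone_cell_bounds q (vec_of y) a b qS a0 ab b1 ye yT.
have Ey : inner (vec_of y) (vec_of y) = y 0%N * y 0%N + Nout y.
  rewrite /inner big_ord_recl !vec_ofE; congr (_ + _).
  by apply: eq_bigr => i _; rewrite !vec_ofE.
have Eq : inner q (vec_of y) = q0 * y 0%N + Lout y.
  rewrite /inner big_ord_recl !vec_ofE; congr (_ + _).
  by apply: eq_bigr => i _; rewrite !vec_ofE.
move=> j /andP[_ jd]; rewrite /cell_slices; case: eqP => [->|_] /=.
  move: Q0 Q1; rewrite Eq Ey => Q0 Q1.
  by apply/andP; split; nra.
case: eqP => [->|/eqP jk].
  have := sqr_coord_le_inner (vec_of y) k; rewrite vec_ofE => h.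
  by rewrite /= in_itv /=; apply/andP; split; nra.
have {}jk : Ordinal jd != k by [].
rewrite -[j]/(nat_of_ord (Ordinal jd)) axis_centerE//.
have := coord_window q (vec_of y) (Ordinal jd) k b qS Nb; rewrite !vec_ofE.
rewrite (_ : _ - _ = (y (Ordinal jd) - y k * q 0 (Ordinal jd) / q 0 k) * q 0 k);
  last by field.
rewrite normrM -ler_pdivlMr ?normr_gt0// ler_norml /= in_itv /= => /andP[h1 h2].
by apply/andP; split; lra.
Qed.

(** A thin tube of points s q + z, with z small and z_k = 0: s = y_k / q_k ranges over 3/8 +- 1/8,
    and [|q 0 k|] allows either sign of q_k. *)
Definition near_axis_slices (w : R) (j : nat) y : set R :=
  if j == k then `[3 / 8 * q 0 k - `|q 0 k| / 8, 3 / 8 * q 0 k + `|q 0 k| / 8]%classic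
  else `[axis_center j y - w, axis_center j y + w]%classic.

Lemma near_axis_slices_outer w j y y' :
  (forall i, (j < i)%N -> y i = y' i) ->
  near_axis_slices w j y = near_axis_slices w j y'.
Proof.
move=> h; rewrite /near_axis_slices; case: ifP => // _.
by rewrite (axis_center_outer _ _ _ h).
Qed.

Lemma measurable_near_axis_slices w j y : measurable (near_axis_slices w j y).
Proof. by rewrite /near_axis_slices; case: ifP => _; exact: measurable_itv. Qed.

Definition near_axis_bound (w : R) (j : nat) : R :=
  if j == k then 2 * (`|q 0 k| / 8) else 2 * w.

Lemma measure_near_axis_slices w j y : 0 <= w ->
  ((near_axis_bound w j)%:E <= mu (near_axis_slices w j y))%E.
Proof.
move=> w0; rewrite /near_axis_slices /near_axis_bound.
by case: ifP => _; rewrite measure_ball_itv// divr_ge0.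
Qed.

(** Write Y = s q + z. The width gives |z|^2 <= t/64, so <q,Y> lies in [1/8, 5/8] and |Y|^2 <=
    <q,Y>^2 + t/64. This yields |Y| <= 1 and (1-t)|Y| <= <q,Y>, that is T <= t. *)
Lemma near_axis_in_cone t y : 0 < t -> t <= 1 ->
  upto m.+2 0 (near_axis_slices (Num.sqrt t / (8 * m.+2%:R))) y ->
  0 < enorm (vec_of y) <= 1 /\ Tval q (normalize (vec_of y)) <= t.
Proof.
move=> t0 t1 yS; set Y := vec_of y.
pose s := y k / q 0 k; pose z := Y - s *: q.
have sb : 1 / 4 <= s <= 1 / 2.
  have := yS k (ltn_ord k); rewrite /near_axis_slices eqxx /= in_itv /=.
  have ys : y k = s * q 0 k by rewrite /s divfK.
  rewrite ys => /andP[h1 h2].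
  have [qp|qn] := ltP 0 (q 0 k).
    by move: h1 h2; rewrite ger0_norm ?(ltW qp)// => h1 h2; apply/andP; split; nra.
  have {}qn : q 0 k < 0 by rewrite lt_neqAle qk0.
  by move: h1 h2; rewrite ltr0_norm// => h1 h2; apply/andP; split; nra.
have md : 1 <= m.+2%:R :> R by rewrite ler1n.
have zj j : z 0 j ^+ 2 <= t / (64 * m.+2%:R).
  have [jk|jk] := eqVneq j k.
    rewrite /z !mxE jk /s divfK// subrr expr0n /=.
    by apply: divr_ge0; [exact: ltW|exact: mulr_ge0].
  have := yS j (ltn_ord j); rewrite /near_axis_slices.
  have -> : (nat_of_ord j == k) = false by apply/negbTE.
  rewrite axis_centerE// /= in_itv /= => /andP[h1 h2].
  rewrite /z !mxE (_ : s * _ = y k * q 0 j / q 0 k); last first.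
    by rewrite /s mulrAC.
  have h : `|y j - y k * q 0 j / q 0 k| <= Num.sqrt t / (8 * m.+2%:R).
    rewrite ler_norml; move: h1 h2; set c := y k * _ / _; set w := Num.sqrt t / _.
    by move=> h1 h2; apply/andP; split; lra.
  rewrite -(real_normK (num_real _)).
  apply: (@le_trans _ _ ((Num.sqrt t / (8 * m.+2%:R)) ^+ 2)).
    by rewrite ler_sqr ?nnegrE// divr_ge0 ?mulr_ge0.
  rewrite expr_div_n sqr_sqrtr ?(ltW t0)// ler_pM2l// lef_pV2 ?posrE; nra.
have zz : inner z z <= t / 64.
  apply: (@le_trans _ _ (\sum_(i < m.+2) (t / (64 * m.+2%:R)))).
    by apply: ler_sum => i _; rewrite -expr2.
  rewrite sumr_const card_ord -(mulr_natr (t / _)).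
  have -> : t / (64 * m.+2%:R) * m.+2%:R = t / 64.
    by field; rewrite ?gt_eqF// (lt_le_trans _ md).
  exact: lexx.
have YE : Y = s *: q + z by rewrite /z addrC subrK.
clearbody z; have hz := sqr_inner_le q z qS.
have qq : inner q q = 1 by exact: qS.
have pE : inner q Y = s + inner q z by rewrite YE innerDr innerZr qq mulr1.
have NE : inner Y Y = (s + inner q z) ^+ 2 + (inner z z - inner q z ^+ 2).
  rewrite YE innerDl !innerDr !innerZl !innerZr qq (innerC z q); ring.
move: hz pE NE; set h := inner q z => hz pE NE.
case/andP: sb => sb1 sb2.
have hh : h ^+ 2 <= 1 / 64 by lra.
have hb : - (1 / 8) <= h <= 1 / 8.
  by rewrite -ler_norml -ler_sqr ?nnegrE// real_normK ?num_real//; lra.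
case/andP: hb => hb1 hb2.
have p0 : 1 / 8 <= inner q Y by rewrite pE; lra.
have p2 : 1 / 64 <= inner q Y ^+ 2.
  by apply: (@le_trans _ _ ((1 / 8) ^+ 2)); [lra|rewrite ler_sqr ?nnegrE; lra].
have N1 : inner Y Y <= inner q Y ^+ 2 + t / 64 by rewrite NE pE; have := sqr_ge0 h; lra.
have N2 : inner q Y ^+ 2 <= inner Y Y by exact: sqr_inner_le.
have p1 : inner q Y <= 5 / 8 by rewrite pE; lra.
have e0 : 0 < enorm Y by rewrite /enorm sqrtr_gt0; lra.
have e2 := sqr_enorm Y.
split.
  rewrite e0 /= -ler_sqr ?nnegrE ?(ltW e0)// e2 expr1n.
  suff : inner q Y ^+ 2 <= (5 / 8) ^+ 2 by lra.
  by rewrite ler_sqr ?nnegrE; lra.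
rewrite Tval_normalize lerBlDr -lerBlDl ler_pdivlMr//.
have : ((1 - t) * enorm Y) ^+ 2 <= inner q Y ^+ 2.
  rewrite exprMn e2; apply: (@le_trans _ _ ((1 - t) ^+ 2 * (inner q Y ^+ 2 + t / 64))).
    by rewrite ler_wpM2l// sqr_ge0.
  move: p2; set p := inner q Y ^+ 2 => p2.
  have h1' : 0 <= (p - 1 / 64) * (t * (2 - t)) by rewrite !mulr_ge0//; lra.
  have h2' : 0 <= t / 64 * (1 + t * (1 - t)).
    by rewrite mulr_ge0// ?addr_ge0// ?mulr_ge0//; lra.
  (* Both summands are nonnegative because [p], the square of <q,Y>, is at least 1/64 and t <= 1. *)
  rewrite -subr_ge0 (_ : _ - _ =
    (p - 1 / 64) * (t * (2 - t)) + t / 64 * (1 + t * (1 - t))); last by field.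
  exact: addr_ge0.
by rewrite ler_sqr ?nnegrE ?mulr_ge0 ?subr_ge0 ?(ltW e0)//; lra.
Qed.

End Geometry.
End ConeEstimates.

(** * Mass of small cells and caps *)

Section SphereMass.
Context {R : realType} {m : nat}.
Local Notation vec := 'rV[R]_m.+2.
Variables (q : vec) (rho : vec -> R).
Hypothesis qS : sphere m.+2 q.
Hypothesis rho0 : forall v, sphere m.+2 v -> 0 <= rho v.
Hypothesis rho_cont : {for q, continuous (fun v => rho (normalize v))}.
Hypothesis rhoq : 0 < rho q.

Lemma cone_integrand_ge0 (A : set vec) y : (0 <= cone_integrand rho A y)%E.
Proof.
rewrite /cone_integrand indicE -EFinM lee_fin.
case: (boolP (_ \in _)) => [/set_mem /= [/andP[y0 _] _]|_]; last by rewrite mul0r.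
by rewrite mul1r rho0//; exact: sphere_normalize.
Qed.

Lemma sphere_int_cell_le_prod (k : 'I_m.+2) (A : set vec) (a b : R) :
  q 0 k != 0 -> (forall j : 'I_m.+2, (k < j)%N -> q 0 j = 0) ->
  0 <= a -> a <= b -> b <= 1 ->
  (forall v, sphere m.+2 v -> Tval q v <= b -> rho v <= 2 * rho q) ->
  q 0 ord0 ^+ 2 - (1 - b) ^+ 2 != 0 ->
  A `<=` [set v | a <= Tval q v <= b] ->
  (sphere_int rho A <= ((m.+2)%:R * (2 * rho q * \prod_(j < m.+2)
    cell_bound q k a b (2 * Num.sqrt (2 * b) / `|q 0 k|) j))%:E)%E.
Proof.
move=> qk0 qk a0 ab b1 rhob A0 Aab.
set w := 2 * Num.sqrt (2 * b) / `|q 0 k|; have w0 : 0 <= w.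
  by rewrite divr_ge0// mulr_ge0// sqrtr_ge0.
rewrite sphere_int_from EFinM; apply: lee_pmul => //.
  by apply: iter_int_from_ge0 => y; exact: cone_integrand_ge0.
pose S := cell_slices q k a b w; set l := cell_bound _ _ _ _ _.
have l0 j : 0 <= l j.
  rewrite /l /cell_bound; case: eqP => _; last by case: ifP => _; rewrite mulr_ge0.
  by rewrite mulr_ge0// sqrtr_ge0.
apply: le_trans.
  apply: (@iter_int_from_le _ m.+2 S _ _ l (2 * rho q)) => //.
  - exact: cell_slices_outer.
  - exact: measurable_cell_slices.
  - by move=> j y _; exact: measure_cell_slices.
  - by rewrite mulr_ge0// ltW.
  - by move=> y; exact: cone_integrand_ge0.
  move=> y; rewrite /cone_integrand indicE -EFinM lee_fin.
  case: (boolP (_ \in _)) => [/set_mem /= [ye /Aab /= yA]|_]; last first.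
    by rewrite mul0r mulr_ge0// mulr_ge0// ltW.
  rewrite mul1r indicE mem_set ?mulr1; last exact: cell_in_slices.
  by case/andP: ye => y0 _; case/andP: yA => _ yb; apply: rhob => //; exact: sphere_normalize.
rewrite lee_fin; apply: ler_piMr.
  by rewrite mulr_ge0// ?prodr_ge0// mulr_ge0// ltW.
by rewrite indicE; case: (_ \in _).
Qed.

(** Multiply the slice lengths. If k = 0, slice 0 is of order sqrt((b-a)/b) and the other m+1 slices
    of order sqrt b. Otherwise slice 0 is of order sqrt(b-a), slice k has length 2, and the
    remaining m are of order sqrt b. *)
Lemma sphere_int_cell_le : exists C b0 : R, [/\ 0 < C, 0 < b0 &
  forall (A : set vec) a b, 0 <= a -> a <= b -> 0 < b -> b <= b0 ->
    A `<=` [set v | a <= Tval q v <= b] ->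
    (sphere_int rho A <= (C * Num.sqrt b ^+ m * Num.sqrt (b - a))%:E)%E].
Proof.
have [b1 b10 near_q] := near_sphere_continuous q rho qS rho_cont rhoq.
have rhob b : b <= b1 ->
    forall v, sphere m.+2 v -> Tval q v <= b -> rho v <= 2 * rho q.
  by move=> bb1 v vS vb; have /andP[] := near_q v vS (le_trans vb bb1).
have [k qk0 qk] := last_nonzero_coord q qS.
have nqk : 0 < `|q 0 k| by rewrite normr_gt0.
pose K := 4 * Num.sqrt 2 / `|q 0 k|.
have K0 : 0 < K by rewrite /K divr_gt0// mulr_gt0// sqrtr_gt0.
have wE b : 0 <= b -> 2 * (2 * Num.sqrt (2 * b) / `|q 0 k|) = K * Num.sqrt b.
  by move=> b0; rewrite /K sqrtrM//; field; rewrite gt_eqF.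
have qq : q 0 ord0 ^+ 2 + \sum_(i < m.+1) q 0 (lift ord0 i) ^+ 2 = 1.
  have <- : inner q q = 1 by exact: qS.
  by rewrite /inner [RHS]big_ord_recl.
have [k0|kN0] := eqVneq k ord0.
- have q01 : q 0 ord0 ^+ 2 = 1.
    rewrite -[RHS]qq big1 ?addr0// => i _.
    by rewrite qk ?expr0n// k0.
  exists ((m.+2)%:R * (2 * rho q * (2 * Num.sqrt 2 * K ^+ m.+1))), (Num.min b1 1).
  split=> [||A a b a0 ab b0]; first 2 last.
  + rewrite le_min => /andP[bb1 b1'] Aab.
    have AE : q 0 ord0 ^+ 2 - (1 - b) ^+ 2 = b * (2 - b) by rewrite q01; ring.
    have bA : b <= b * (2 - b) by nra.
    apply: le_trans.
      apply: (sphere_int_cell_le_prod k A a b) => //; first exact: rhob.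
      by rewrite AE gt_eqF// (lt_le_trans b0).
    rewrite lee_fin [leRHS](_ : _ = (m.+2)%:R * (2 * rho q *
      (2 * Num.sqrt 2 * K ^+ m.+1 * Num.sqrt b ^+ m * Num.sqrt (b - a))));
      last by ring.
    apply: ler_wpM2l => //; apply: ler_wpM2l; first by rewrite mulr_ge0// ltW.
    rewrite big_ord_recl {1}/cell_bound eqxx AE.
    rewrite (eq_bigr (fun=> K * Num.sqrt b)); last first.
      move=> i _; rewrite /cell_bound.
      have -> : (nat_of_ord (lift ord0 i) == k) = false by rewrite k0.
      by rewrite /= wE// ltW.
    rewrite prodr_const card_ord exprMn.
    rewrite [leRHS](_ : _ = 2 * (Num.sqrt 2 * Num.sqrt (b - a) / Num.sqrt b)
        * (K ^+ m.+1 * Num.sqrt b ^+ m.+1)); last first.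
      by rewrite [in RHS](exprS (Num.sqrt b)); field; rewrite gt_eqF// sqrtr_gt0.
    apply: ler_wpM2r; first by rewrite mulr_ge0 ?exprn_ge0 ?sqrtr_ge0// ltW.
    apply: ler_wpM2l => //.
    rewrite -sqrtrM// -sqrtrV ?(ltW b0)// -sqrtrM ?mulr_ge0// ?subr_ge0//.
    rewrite ler_wsqrtr// ger0_norm ?(le_trans (ltW b0))//.
    by rewrite ler_wpM2l ?mulr_ge0 ?subr_ge0// lef_pV2 ?posrE// (lt_le_trans b0).
  + by rewrite !mulr_gt0// ?exprn_gt0// sqrtr_gt0.
  + by rewrite lt_min b10 ltr01.
- have [k' kE] : exists k' : 'I_m.+1, k = lift ord0 k'.
    by case: (unliftP ord0 k) kN0 => [k' ->|->]; [exists k'|rewrite eqxx].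
  have q0k : q 0 ord0 ^+ 2 <= 1 - q 0 k ^+ 2.
    rewrite -qq (bigD1 k')//= -kE lerBrDr lerD2l lerDl.
    by apply: sumr_ge0 => i _; rewrite sqr_ge0.
  have qk2 : 0 < q 0 k ^+ 2 by rewrite exprn_even_gt0.
  exists ((m.+2)%:R * (2 * rho q * (2 * (2 / `|q 0 k|) * (2 * K ^+ m)))),
    (Num.min b1 (Num.min 1 (q 0 k ^+ 2 / 4))).
  split=> [||A a b a0 ab b0]; first 2 last.
  + rewrite !le_min => /and3P[bb1 b1' bq] Aab.
    (* The leading coefficient stays away from 0: (1-b)^2 - q_0^2 >= q_k^2 - 2b, and b <= q_k^2 /
       4. *)
    have AE : q 0 k ^+ 2 / 2 <= - (q 0 ord0 ^+ 2 - (1 - b) ^+ 2) by nra.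
    have A0 : q 0 ord0 ^+ 2 - (1 - b) ^+ 2 < 0.
      by rewrite -oppr_gt0 (lt_le_trans _ AE)// divr_gt0.
    apply: le_trans.
      apply: (sphere_int_cell_le_prod k A a b) => //; first exact: rhob.
      by rewrite lt_eqF.
    rewrite lee_fin [leRHS](_ : _ = (m.+2)%:R * (2 * rho q *
      (2 * (2 / `|q 0 k|) * (2 * K ^+ m) * Num.sqrt b ^+ m * Num.sqrt (b - a))));
      last by ring.
    apply: ler_wpM2l => //; apply: ler_wpM2l; first by rewrite mulr_ge0// ltW.
    rewrite big_ord_recl {1}/cell_bound eqxx ltr0_norm//.
    rewrite (bigD1 k')//= {1}/cell_bound /= kE eqxx /=.
    rewrite (eq_bigr (fun=> K * Num.sqrt b)); last first.
      move=> i ik; rewrite /cell_bound.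
      have -> : (nat_of_ord (lift ord0 i) == lift ord0 k') = false.
        by rewrite !lift0 eqSS; apply/negbTE.
      by rewrite /= -kE wE// ltW.
    rewrite prodr_const (_ : #|_| = m); last first.
      by have := cardC1 k'; rewrite card_ord.
    rewrite -kE exprMn [leRHS](_ : _ = 2 * (2 / `|q 0 k| * Num.sqrt (b - a)) *
      (2 * 1 * (K ^+ m * Num.sqrt b ^+ m))); last by ring.
    apply: ler_wpM2r; first by rewrite !mulr_ge0 ?exprn_ge0 ?sqrtr_ge0// ltW.
    apply: ler_wpM2l => //.
    rewrite [leRHS](_ : _ = Num.sqrt ((b - a) * (4 / q 0 k ^+ 2))); last first.
      rewrite sqrtrM ?subr_ge0// mulrC; congr (_ * _).
      have -> : 4 / q 0 k ^+ 2 = (2 / q 0 k) ^+ 2 :> R by field.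
      by rewrite sqrtr_sqr normf_div (@ger0_norm _ 2).
    rewrite ler_wsqrtr// mulrAC mulrC ler_wpM2l ?subr_ge0//.
    by rewrite ler_pdivrMr ?oppr_gt0// mulrAC ler_pdivlMr//; lra.
  + by rewrite !mulr_gt0// ?exprn_gt0// invr_gt0.
  + by rewrite !lt_min b10 ltr01 divr_gt0.
Qed.

(** The tube around the axis has one slice of length |q_k|/4 and m+1 slices of length proportional
    to sqrt t; near q the density is at least rho(q)/2. *)
Lemma sphere_int_cap_ge : exists c t0 : R, [/\ 0 < c, 0 < t0 &
  forall (A : set vec) t, 0 < t -> t <= t0 ->
    sphere m.+2 `&` [set v | Tval q v <= t] `<=` A ->
    ((c * Num.sqrt t ^+ m.+1)%:E <= sphere_int rho A)%E].
Proof.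
have [b1 b10 near_q] := near_sphere_continuous q rho qS rho_cont rhoq.
have [k qk0 qk] := last_nonzero_coord q qS.
have nqk : 0 < `|q 0 k| by rewrite normr_gt0.
exists ((m.+2)%:R * (rho q / 2 * (2 * (`|q 0 k| / 8) *
  (2 / (8 * m.+2%:R)) ^+ m.+1))), (Num.min b1 1).
split=> [||A t t0]; first 2 last.
- rewrite le_min => /andP[tb1 t1] At.
  have w0 : 0 <= Num.sqrt t / (8 * m.+2%:R) by rewrite divr_ge0// sqrtr_ge0.
  rewrite sphere_int_from -mulrA EFinM; apply: lee_pmul => //.
    by rewrite lee_fin !mulr_ge0// ?exprn_ge0 ?sqrtr_ge0// ltW.
  pose S := near_axis_slices q k (Num.sqrt t / (8 * m.+2%:R)).
  pose l := near_axis_bound q k (Num.sqrt t / (8 * m.+2%:R)).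
  have l0 j : 0 <= l j.
    by rewrite /l /near_axis_bound; case: ifP => _; rewrite mulr_ge0// divr_ge0.
  apply: le_trans; last first.
    apply: (@iter_int_from_ge _ m.+2 S _ _ l (rho q / 2)) => //.
    + exact: near_axis_slices_outer.
    + exact: measurable_near_axis_slices.
    + by move=> j y _; exact: measure_near_axis_slices.
    + by rewrite divr_ge0// ltW.
    move=> y; rewrite [\1__ _]indicE.
    case: (boolP (_ \in _)) => [/set_mem yS|_]; last first.
      by rewrite mulr0; exact: cone_integrand_ge0.
    have [ye yt] := near_axis_in_cone q k qS qk0 qk t y t0 t1 yS.
    have ySph : sphere m.+2 (normalize (vec_of y)).
      by case/andP: ye => y0 _; exact: sphere_normalize.
    rewrite /cone_integrand indicE mem_set /=; last by split=> //; exact: At.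
    rewrite mul1e mulr1 lee_fin.
    by have /andP[] := near_q _ ySph (le_trans yt tb1).
  rewrite lee_fin indicE mem_set ?mulr1; last first.
    by move=> j /andP[h1 h2]; move: (leq_trans h2 h1); rewrite ltnn.
  rewrite [leLHS](_ : _ = rho q / 2 * (2 * (`|q 0 k| / 8) *
    (2 * (Num.sqrt t / (8 * m.+2%:R))) ^+ m.+1)); last first.
    have -> : 2 * (Num.sqrt t / (8 * m.+2%:R)) = 2 / (8 * m.+2%:R) * Num.sqrt t.
      by rewrite mulrA mulrAC.
    by rewrite [in RHS](exprMn _ (2 / _)) !mulrA.
  apply: ler_wpM2l; first by rewrite divr_ge0// ltW.
  rewrite (bigD1 k)//= {1}/l /near_axis_bound eqxx.
  apply: ler_wpM2l; first by rewrite mulr_ge0// divr_ge0.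
  rewrite (eq_bigr (fun=> 2 * (Num.sqrt t / (8 * m.+2%:R)))); last first.
    by move=> i ik; rewrite /l /near_axis_bound (negbTE (_ : nat_of_ord i != k)).
  rewrite prodr_const (_ : #|_| = m.+1); last first.
    by have := cardC1 k; rewrite card_ord.
  exact: lexx.
- by rewrite !mulr_gt0// ?exprn_gt0// ?divr_gt0// ?mulr_gt0.
- by rewrite lt_min b10 ltr01.
Qed.

End SphereMass.

(** * Concentration of the softmax weights *)

Section SoftmaxGap.
Context {R : realType}.
Implicit Types (b h eps : R) (t : nat -> R).

Definition softmax b t (n j : nat) : R :=
  expR (- b * t j) / \sum_(i < n) expR (- b * t i).

(** Keep one term of the exponential series of y and invert. *)
Lemma expRN_le_pow (M : nat) (y : R) : 0 < y ->
  expR (- y) <= M.+1`!%:R / y ^+ M.+1.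
Proof.
move=> y0; rewrite expRN -[leRHS]invrK invf_div.
have f0 : 0 < M.+1`!%:R :> R by rewrite ltr0n fact_gt0.
rewrite lef_pV2 ?posrE ?expR_gt0 ?divr_gt0 ?exprn_gt0//.
by apply: le_trans (expR_ge1Dxn M (ltW y0)); rewrite lerDr.
Qed.

(** Let i minimise t. With k = floor(t_j / h) >= 1, the gap t_j - t_i >= t_j / (2N) makes the
    relative weight exp(-b(t_j - t_i)) at most Q k^-(M+1), which is Q times the term of index k - 1
    attached to j in the double sum. If S is the sum of these relative weights, i has weight 1/(1+S)
    > 1 - eps. *)
Lemma softmax_gap (n N Nmax M : nat) b h eps t :
  0 < b -> 0 < h -> (0 < N)%N -> (forall j, (j < n)%N -> 0 <= t j) ->
  (exists2 i, (i < n)%N & t i < N%:R * h) ->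
  (forall i j, (i < n)%N -> (j < n)%N -> i != j -> t i < N%:R * h ->
    h <= `|t i - t j|) ->
  (forall j, (j < n)%N -> t j < Nmax.+1%:R * h) ->
  M.+1`!%:R / (b * h / (2 * N%:R)) ^+ M.+1 *
    (\sum_(j < n) \sum_(k < Nmax) k.+1%:R ^- M.+1 * (t j < k.+2%:R * h)%R%:R) < eps ->
  exists2 i, (i < n)%N & 1 - eps < softmax b t n i.
Proof.
move=> b0 h0 N0 t0 [i0 i0n ti0] gap tmax; set Q := _ / _ ^+ _ => Ylt.
have N0' : 0 < N%:R :> R by rewrite ltr0n.
have bhN : 0 < b * h / (2 * N%:R) by rewrite divr_gt0 ?mulr_gt0.
have Q0 : 0 < Q by rewrite divr_gt0 ?exprn_gt0// ltr0n fact_gt0.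
have [i _ imin] := @arg_minP _ _ 'I_n (Ordinal i0n) xpredT (fun i => t i) isT.
have ti : t i < N%:R * h by apply: le_lt_trans ti0; exact: (imin (Ordinal i0n)).
pose S := \sum_(j < n | j != i) expR (- b * (t j - t i)).
have S0 : 0 <= S by apply: sumr_ge0 => j _; exact: expR_ge0.
have term (j : 'I_n) : j != i -> expR (- b * (t j - t i)) <=
    Q * \sum_(k < Nmax) k.+1%:R ^- M.+1 * (t j < k.+2%:R * h)%R%:R.
  move=> ji; have tij : h <= t j - t i.
    have := gap i j (ltn_ord i) (ltn_ord j); rewrite eq_sym => /(_ ji ti).
    by rewrite distrC ger0_norm// subr_ge0; exact: imin.
  have ti0' := t0 i (ltn_ord i).
  have tj0 : 0 <= t j / h by rewrite divr_ge0 ?t0// ltW.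
  have /andP[] := truncn_itv tj0.
  set k := Num.trunc _; rewrite ler_pdivlMr// ltr_pdivrMr// => k1 k2.
  have k0 : (0 < k)%N.
    rewrite -ltnS -(ltr_nat R) -(ltr_pM2r h0) mul1r.
    by apply: le_lt_trans k2; lra.
  have kN : (k.-1 < Nmax)%N.
    rewrite -ltnS prednK// -(ltr_nat R) -(ltr_pM2r h0).
    by apply: le_lt_trans k1 (tmax _ _).
  rewrite (bigD1 (Ordinal kN))//= prednK// k2 mulr1.
  apply: (@le_trans _ _ (Q * k%:R ^- M.+1)); last first.
    rewrite ler_wpM2l ?(ltW Q0)// lerDl; apply: sumr_ge0 => l _.
    by rewrite mulr_ge0// invr_ge0 exprn_ge0.
  (* If t_j <= 2Nh the gap h suffices; otherwise t_i < Nh < t_j / 2. *)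
  have kapp : t j / (2 * N%:R) <= t j - t i.
    rewrite ler_pdivrMr ?mulr_gt0//.
    have [tjN|tjN] := leP (t j) (2 * N%:R * h).
      by apply: le_trans tjN _; rewrite mulrC ler_pM2r ?mulr_gt0.
    have : 1 <= N%:R :> R by rewrite ler1n.
    by nra.
  have k00 : 0 < k%:R :> R by rewrite ltr0n.
  have bk : b * h / (2 * N%:R) * k%:R <= b * (t j - t i).
    rewrite [leLHS](_ : _ = b * (k%:R * h / (2 * N%:R))); last first.
      by field; rewrite gt_eqF.
    rewrite ler_pM2l//; apply: le_trans kapp.
    by rewrite ler_pM2r// invr_gt0 mulr_gt0.
  rewrite mulNr; apply: le_trans.
    apply: (@le_trans _ _ (expR (- (b * h / (2 * N%:R) * k%:R)))).
      by rewrite ler_expR lerN2.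
    by apply: (expRN_le_pow M); rewrite mulr_gt0.
  by rewrite exprMn invfM mulrA.
have Slt : S < eps.
  apply: le_lt_trans Ylt; rewrite big_distrr /=.
  rewrite [leRHS](bigD1 i)//= -[leLHS]add0r; apply: lerD; last first.
    by apply: ler_sum => j; exact: term.
  rewrite mulr_ge0 ?(ltW Q0)//; apply: sumr_ge0 => l _.
  by rewrite mulr_ge0// invr_ge0 exprn_ge0.
exists i => //; rewrite /softmax.
have -> : \sum_(j < n) expR (- b * t j) = expR (- b * t i) * (1 + S).
  rewrite (bigD1 i)//= mulrDr mulr1 big_distrr /=; congr (_ + _).
  by apply: eq_bigr => j _; rewrite -expRD; congr expR; ring.
rewrite invfM mulrA divff ?gt_eqF ?expR_gt0// mul1r.
have S1 : 0 < 1 + S by rewrite ltr_pwDl.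
rewrite -div1r ltr_pdivlMr//; nra.
Qed.

End SoftmaxGap.

(** * Real-valued probabilities, union bound and Markov inequality *)

Section Probability.
Context {R : realType} {dO : measure_display} {Omega : measurableType dO}.
Variable P : probability Omega R.
Implicit Types A B : set Omega.

Definition pr A : R := fine (P A).

Lemma prE A : measurable A -> P A = (pr A)%:E.
Proof. by move=> mA; rewrite /pr fineK// fin_num_measure. Qed.

Lemma pr_ge0 A : 0 <= pr A.
Proof. by rewrite /pr fine_ge0. Qed.

Lemma pr_le1 A : measurable A -> pr A <= 1.
Proof. by move=> mA; rewrite -lee_fin -prE// probability_le1. Qed.

Lemma le_pr A B : measurable A -> measurable B -> A `<=` B -> pr A <= pr B.
Proof.
by move=> mA mB AB; rewrite -lee_fin -!prE//; apply: le_measure; rewrite ?inE.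
Qed.

Lemma pr_setD A B : measurable A -> measurable B -> A `<=` B ->
  pr (B `\` A) = pr B - pr A.
Proof.
move=> mA mB AB; apply: EFin_inj; rewrite EFinB -!prE//; last exact: measurableD.
rewrite measureD// ?setIidr//.
by rewrite (le_lt_trans (probability_le1 _ _))// ltry.
Qed.

Lemma pr_sub_sum (n : nat) (B : nat -> set Omega) A : measurable A ->
  (forall k, measurable (B k)) ->
  (forall w, A w -> exists2 k, (k < n)%N & B k w) ->
  pr A <= \sum_(k < n) pr (B k).
Proof.
move=> mA mB AB; rewrite -lee_fin -prE// -sumEFin.
rewrite (eq_bigr (fun k : 'I_n => P (B k))); last by move=> k _; rewrite prE.
apply: content_subadditive => // w /AB[k kn Bk].
by rewrite -bigcup_mkord; exists k.
Qed.

Lemma pr_setU3 A B1 B2 B3 : measurable A -> measurable B1 -> measurable B2 ->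
  measurable B3 -> A `<=` B1 `|` B2 `|` B3 -> pr A <= pr B1 + pr B2 + pr B3.
Proof.
move=> mA m1 m2 m3 AB.
have := @pr_sub_sum 3 (fun k => if k == 0%N then B1 else if k == 1%N then B2 else B3) A mA.
rewrite !big_ord_recl big_ord0 /= addr0 addrA; apply.
  by move=> k; case: ifP => // _; case: ifP.
by move=> w /AB[[|]|]; [exists 0%N|exists 1%N|exists 2%N].
Qed.

(** Integrate the pointwise inequality between theta 1_A and the weighted sum of indicators. *)
Lemma markov_indic_sum (I : finType) (c : I -> R) (B : I -> set Omega) (theta : R) A :
  (forall i, 0 <= c i) -> (forall i, measurable (B i)) -> 0 <= theta ->
  measurable A -> (forall w, A w -> theta <= \sum_i c i * \1_(B i) w) ->
  theta * pr A <= \sum_i c i * pr (B i).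
Proof.
move=> c0 mB th0 mA AB.
rewrite -lee_fin EFinM -prE// -sumEFin.
rewrite (eq_bigr (fun i => \int[P]_w (c i * \1_(B i) w)%:E)%E); last first.
  by move=> i _; rewrite integral_scale_indic// EFinM -prE.
rewrite -integral_scale_indic// -ge0_integral_sum//; last 2 first.
- by move=> i; apply/measurable_EFinP/measurable_funM => //; exact: measurable_indic.
- by move=> i w _; rewrite lee_fin mulr_ge0.
apply: ge0_le_integral_nomeas => w; first by rewrite lee_fin mulr_ge0.
rewrite sumEFin lee_fin indicE; case: (boolP (w \in A)) => [/set_mem/AB|_].
  by rewrite mulr1.
by rewrite mulr0; apply: sumr_ge0 => i _; rewrite mulr_ge0.
Qed.

End Probability.

(** * Probability that no single weight dominates *)

Section SoftmaxConcentration.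
Context {R : realType} {dO : measure_display} {Omega : measurableType dO}.
Variables (P : probability Omega R) (T : nat -> Omega -> R) (m : nat).
Variables (C b0 c t0 : R).
Hypotheses (C0 : 0 < C) (b00 : 0 < b0) (c0 : 0 < c) (t00 : 0 < t0).
Hypothesis mT : forall i (B : set R), measurable B -> measurable (T i @^-1` B).
Hypothesis T02 : forall i w, 0 <= T i w <= 2.
Hypothesis cell_le : forall i a b, 0 <= a -> a <= b -> 0 < b -> b <= b0 ->
  pr P (T i @^-1` `[a, b[) <= C * Num.sqrt b ^+ m * Num.sqrt (b - a).
Hypothesis cap_ge : forall i t, 0 < t -> t <= t0 ->
  c * Num.sqrt t ^+ m.+1 <= pr P (T i @^-1` `[0, 2 * t[).
Hypothesis indep : forall (s : seq nat) (B : nat -> set R),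
  uniq s -> (forall i, measurable (B i)) ->
  P (\bigcap_(i in [set` s]) (T i @^-1` B i)) =
    (\prod_(i <- s) P (T i @^-1` B i))%E.

Let mTi i (I : interval R) : measurable (T i @^-1` [set` I]).
Proof. by apply: mT; exact: measurable_itv. Qed.

Lemma pr_bigcap (s : seq nat) (B : nat -> set R) :
  uniq s -> (forall i, measurable (B i)) ->
  pr P (\bigcap_(i in [set` s]) (T i @^-1` B i)) =
    \prod_(i <- s) pr P (T i @^-1` B i).
Proof.
move=> us mB; rewrite {1}/pr indep// (eq_bigr (fun i => (pr P (T i @^-1` B i))%:E)).
  by rewrite prodEFin.
by move=> i _; rewrite prE//; exact: mT.
Qed.

Lemma pr_pair i j (A B : set R) : i != j -> measurable A -> measurable B ->
  pr P (T i @^-1` A `&` T j @^-1` B) = pr P (T i @^-1` A) * pr P (T j @^-1` B).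
Proof.
move=> ij mA mB; pose D l := if l == i then A else B.
have Di : D i = A by rewrite /D eqxx.
have Dj : D j = B by rewrite /D eq_sym (negbTE ij).
have := @pr_bigcap [:: i; j] D; rewrite /= inE ij => /(_ isT).
rewrite !big_cons big_nil mulr1 Di Dj => <-; last by move=> l; rewrite /D; case: ifP.
congr pr; apply/seteqP; split=> w /=.
  by move=> [wA wB] l /=; rewrite !inE => /orP[]/eqP ->; rewrite ?Di ?Dj.
move=> h; split; first by have := h i; rewrite /= !inE eqxx Di; exact.
by have := h j; rewrite /= !inE eqxx orbT Dj; exact.
Qed.

(* The constant of [below_le]; the second term covers s > b0, where the probability
   is bounded by 1. *)
Let CF := C + (Num.sqrt b0 ^+ m.+1)^-1.

Let CF0 : 0 < CF.
Proof. by rewrite addr_gt0// invr_gt0 exprn_gt0// sqrtr_gt0. Qed.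

Lemma below_le i s : 0 < s -> pr P (T i @^-1` `[0, s[) <= CF * Num.sqrt s ^+ m.+1.
Proof.
move=> s0; have ss : 0 < Num.sqrt s by rewrite sqrtr_gt0.
have sb : 0 < Num.sqrt b0 by rewrite sqrtr_gt0.
have [sle|slt] := leP s b0.
  apply: (le_trans (cell_le i 0 s _ _ _ _)) => //; first exact: ltW.
  rewrite subr0 -mulrA -exprSr ler_wpM2r ?exprn_ge0 ?sqrtr_ge0//.
  by rewrite lerDl invr_ge0 exprn_ge0// ltW.
apply: (le_trans (pr_le1 P _ (mTi _ _))).
apply: (@le_trans _ _ ((Num.sqrt b0 ^+ m.+1)^-1 * Num.sqrt s ^+ m.+1)).
  rewrite ler_pdivlMl ?exprn_gt0// mulr1 lerXn2r// ?nnegrE ?ltW//.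
  by rewrite ltr_sqrt.
by rewrite ler_wpM2r ?exprn_ge0 ?sqrtr_ge0// lerDr ltW.
Qed.

(** Independence, with 1 - p <= exp(-p) in each factor. *)
Lemma all_above_le n t : 0 < t -> t <= t0 ->
  pr P (\bigcap_(i in [set` iota 0 n]) (T i @^-1` `[2 * t, +oo[))
    <= expR (- (n%:R * (c * Num.sqrt t ^+ m.+1))).
Proof.
move=> tp tt0; rewrite pr_bigcap ?iota_uniq//.
apply: (@le_trans _ _ (\prod_(i <- iota 0 n) expR (- (c * Num.sqrt t ^+ m.+1)))).
  apply: ler_prod => i _; rewrite pr_ge0 /=.
  have -> : T i @^-1` `[2 * t, +oo[ = setT `\` T i @^-1` `[0, 2 * t[.
    apply/seteqP; split=> w /=; rewrite !in_itv /= andbT.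
      by move=> tw; split=> //; rewrite ltNge tw andbF.
    by case=> _ /negP; have /andP[-> _] := T02 i w; rewrite /= -leNgt.
  rewrite pr_setD// {1}/pr probability_setT /=.
  apply: le_trans (expR_ge1Dx _); rewrite lerD2l lerN2.
  exact: cap_ge.
by rewrite big_const_seq count_predT size_iota iter_mulr_1 -expRM_natl mulrN.
Qed.

(* T_i lies in the k-th cell of length h and T_j in that cell or a neighbour;
   for [k = 0] the truncated [k.-1] is harmless because T_j >= 0. *)
Definition near_pair (h : R) (i j k : nat) : set Omega :=
  T i @^-1` `[k%:R * h, k.+1%:R * h[ `&` T j @^-1` `[k.-1%:R * h, k.+2%:R * h[.

Lemma measurable_near_pair h i j k : measurable (near_pair h i j k).
Proof. by apply: measurableI. Qed.

Lemma sum_cells_le i N h : 0 < h ->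
  \sum_(k < N) pr P (T i @^-1` `[k%:R * h, k.+1%:R * h[)
    = pr P (T i @^-1` `[0, N%:R * h[).
Proof.
move=> h0; pose G k := pr P (T i @^-1` `[0, k%:R * h[).
rewrite (eq_bigr (fun k : 'I_N => G k.+1 - G k)).
  rewrite -(big_mkord xpredT (fun k => G k.+1 - G k)) telescope_sumr//.
  rewrite /G mul0r (_ : T i @^-1` `[0, 0[ = set0) ?{2}/pr ?measure0 ?subr0//.
  by apply/seteqP; split=> w //=; rewrite in_itv /= => /andP[]; rewrite leNgt => /negP.
move=> k _; rewrite -pr_setD//.
  congr pr; apply/seteqP; split=> w /=; rewrite !in_itv /=.
    move=> /andP[kw wk]; split; last by rewrite ltNge kw andbF.
    by have /andP[-> _] := T02 i w.
  by move=> [/andP[-> ->]] /negP; rewrite /= -leNgt => ->.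
move=> w /=; rewrite !in_itv /= => /andP[-> /lt_le_trans]; apply.
by rewrite ler_pM2r// ler_nat.
Qed.

(** The window for T_j has length at most 3h and right end at most 2Nh, so by independence it costs
    a factor bounded uniformly in k; the cells of T_i then add up to the cap T_i < Nh. *)
Lemma near_pairs_le i j N h : i != j -> 0 < h -> (0 < N)%N ->
  2 * (N%:R * h) <= b0 ->
  \sum_(k < N) pr P (near_pair h i j k) <=
    CF * Num.sqrt (N%:R * h) ^+ m.+1 *
    (C * Num.sqrt (2 * (N%:R * h)) ^+ m * Num.sqrt (3 * h)).
Proof.
move=> ij h0 N0 Nb; set V := C * _ * _.
have N1 : 1 <= N%:R :> R by rewrite ler1n.
have V0 : 0 <= V by rewrite !mulr_ge0 ?exprn_ge0 ?sqrtr_ge0// ltW.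
apply: (@le_trans _ _ (\sum_(k < N) pr P (T i @^-1` `[k%:R * h, k.+1%:R * h[) * V)).
  apply: ler_sum => k _; rewrite pr_pair//; try exact: measurable_itv.
  rewrite ler_wpM2l ?pr_ge0//.
  have kN : k.+2%:R * h <= 2 * (N%:R * h).
    rewrite mulrA ler_pM2r// -natrM ler_nat.
    by have := ltn_ord k; rewrite mul2n -addnn => kN; rewrite -addn1 leq_add.
  have k2 : 0 < k.+2%:R * h by rewrite mulr_gt0.
  have k3 : k.+2%:R <= k.-1%:R + 3 :> R.
    by rewrite -[3]/(3%:R) -natrD ler_nat; case: (nat_of_ord k) => [|l] //=; rewrite !addnS addn0.
  apply: (le_trans (cell_le j _ _ _ _ _ _)) => //.
  - by rewrite mulr_ge0// ltW.
  - by rewrite ler_pM2r// ler_nat; case: (nat_of_ord k) => //= l; rewrite ltnW// ltnW.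
  - exact: le_trans Nb.
  apply: ler_pM; rewrite ?mulr_ge0 ?exprn_ge0 ?sqrtr_ge0 ?(ltW C0)//.
    rewrite ler_wpM2l ?(ltW C0)// lerXn2r ?nnegrE ?sqrtr_ge0//.
    by rewrite ler_wsqrtr.
  by rewrite ler_wsqrtr// -mulrBl ler_pM2r//; lra.
rewrite -big_distrl /= sum_cells_le// ler_wpM2r//.
by apply: below_le; rewrite mulr_gt0// (lt_le_trans ltr01).
Qed.

Definition close_pair_event (n N : nat) (h : R) : set Omega :=
  \bigcup_(i in `I_n) \bigcup_(j in `I_n)
    \bigcup_(k in `I_N) (if i == j then set0 else near_pair h i j k).

Lemma measurable_close_pair_event n N h : measurable (close_pair_event n N h).
Proof.
do 3 (apply: bigcup_measurable => ? _).
by case: ifP => // _; exact: measurable_near_pair.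
Qed.

Lemma close_pair_event_le n N h : 0 < h -> (0 < N)%N -> 2 * (N%:R * h) <= b0 ->
  pr P (close_pair_event n N h) <=
    n%:R ^+ 2 * (CF * Num.sqrt (N%:R * h) ^+ m.+1 *
    (C * Num.sqrt (2 * (N%:R * h)) ^+ m * Num.sqrt (3 * h))).
Proof.
move=> h0 N0 Nb; set V := CF * _ * _.
have V0 : 0 <= V.
  by rewrite /V !mulr_ge0 ?exprn_ge0 ?sqrtr_ge0// ltW.
pose D i j k := if i == j then set0 else near_pair h i j k.
have mD i j k : measurable (D i j k).
  by rewrite /D; case: ifP => // _; exact: measurable_near_pair.
pose D2 i j := \bigcup_(k in `I_N) D i j k.
have mD2 i j : measurable (D2 i j) by apply: bigcup_measurable.
pose D1 i := \bigcup_(j in `I_n) D2 i j.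
have mD1 i : measurable (D1 i) by apply: bigcup_measurable.
have V2 i j : pr P (D2 i j) <= V.
  apply: (le_trans (pr_sub_sum P N (D i j) _ (mD2 i j) (mD i j) _)).
    by move=> w [k /= kN Dw]; exists k.
  have [ij|ij] := eqVneq i j; last first.
    rewrite (eq_bigr (fun k : 'I_N => pr P (near_pair h i j k))).
      exact: near_pairs_le.
    by move=> k _; rewrite /D (negbTE ij).
  by rewrite big1// => k _; rewrite /D ij eqxx /pr measure0.
have V1 i : pr P (D1 i) <= n%:R * V.
  apply: (le_trans (pr_sub_sum P n (D2 i) _ (mD1 i) (mD2 i) _)).
    by move=> w [k /= kN Dw]; exists k.
  apply: (@le_trans _ _ (\sum_(j < n) V)); first by apply: ler_sum.
  by rewrite sumr_const card_ord mulr_natl.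
apply: (le_trans (pr_sub_sum P n D1 _ (measurable_close_pair_event n N h) mD1 _)).
  by move=> w [k /= kN Dw]; exists k.
apply: (@le_trans _ _ (\sum_(j < n) n%:R * V)); first by apply: ler_sum.
by rewrite sumr_const card_ord -(mulr_natl (n%:R * V)) mulrA expr2.
Qed.

(** Dominates the sum of (h / T_j)^(m+3) over T_j >= h, provided all T_j < (Nmax+1)h, through the
    term k = floor(T_j / h) - 1. With one-sided indicators its expectation only involves caps. *)
Definition far_sum (n Nmax : nat) (h : R) (w : Omega) : R :=
  \sum_(j < n) \sum_(k < Nmax) k.+1%:R ^- m.+3 * (T j w < k.+2%:R * h)%R%:R.

Lemma far_sum_indic n Nmax h w : far_sum n Nmax h w =
  \sum_(p : 'I_n * 'I_Nmax)
    p.2.+1%:R ^- m.+3 * \1_(T p.1 @^-1` `[0, p.2.+2%:R * h[) w.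
Proof.
rewrite /far_sum pair_bigA /=; apply: eq_bigr => p _; congr (_ * _).
rewrite indicE; congr (_%:R); congr nat_of_bool.
apply/idP/idP => [h1|/set_mem]; last by rewrite /= in_itv /= => /andP[].
by apply/mem_set; rewrite /= in_itv /= h1 andbT; case/andP: (T02 p.1 w).
Qed.

Lemma measurable_far_sum_ge n Nmax h theta :
  measurable [set w | theta <= far_sum n Nmax h w].
Proof.
have mf : measurable_fun setT (far_sum n Nmax h).
  rewrite (_ : far_sum n Nmax h = fun w => \sum_(p : 'I_n * 'I_Nmax)
    p.2.+1%:R ^- m.+3 * \1_(T p.1 @^-1` `[0, p.2.+2%:R * h[) w); last first.
    by apply/funext => w; exact: far_sum_indic.
  apply: measurable_sum => p; apply: measurable_funM => //.
rewrite (_ : [set _ | _] = far_sum n Nmax h @^-1` `[theta, +oo[).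
  by rewrite -[X in measurable X]setTI; apply: mf => //; exact: measurable_itv.
by apply/seteqP; split=> w /=; rewrite in_itv /= andbT.
Qed.

(** Induction on the stronger bound 2 - 1/N, using 1/(a+1)^2 <= 1/a - 1/(a+1). *)
Lemma sum_inv_sqr_le N : \sum_(k < N) k.+1%:R ^- 2 <= 2 :> R.
Proof.
case: N => [|N]; first by rewrite big_ord0.
suff : \sum_(k < N.+1) k.+1%:R ^- 2 <= 2 - N.+1%:R^-1 :> R.
  by move=> /le_trans; apply; rewrite lerBlDr lerDl invr_ge0.
elim: N => [|N IH]; first by rewrite big_ord_recr big_ord0 /=; lra.
rewrite big_ord_recr /=; apply: (le_trans (lerD IH (lexx _))).
have n0 : 0 < N.+1%:R :> R by [].
have -> : N.+2%:R = N.+1%:R + 1 :> R by rewrite -natr1.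
move: n0; set a := N.+1%:R => n0.
have -> : 2 - (a + 1)^-1 = 2 - a^-1 + (a * (a + 1))^-1.
  by field; rewrite !gt_eqF// addr_gt0.
rewrite lerD2l lef_pV2 ?posrE ?mulr_gt0 ?exprn_gt0 ?addr_gt0//; nra.
Qed.

(** By the crude sqrt(k+2) <= 2(k+1), the cap T < (k+2)h has probability at most CF (2(k+1) sqrt
    h)^(m+1). The exponent m+3 then leaves the summable factor (k+1)^-2. *)
Lemma far_sum_le n Nmax h theta : 0 < h -> 0 <= theta ->
  theta * pr P [set w | theta <= far_sum n Nmax h w] <=
    n%:R * Num.sqrt h ^+ m.+1 * (CF * 2 ^+ m.+1 * 2).
Proof.
move=> h0 th0.
apply: (@le_trans _ _ (\sum_(p : 'I_n * 'I_Nmax)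
    p.2.+1%:R ^- m.+3 * pr P (T p.1 @^-1` `[0, p.2.+2%:R * h[))).
  apply: markov_indic_sum => //.
  - exact: measurable_far_sum_ge.
  - by move=> w /=; rewrite far_sum_indic.
pose F (j k : nat) := k.+1%:R ^- m.+3 * pr P (T j @^-1` `[0, k.+2%:R * h[).
rewrite -(pair_bigA _ (fun (j : 'I_n) (k : 'I_Nmax) => F j k)) /=.
apply: (@le_trans _ _ (\sum_(j < n) (Num.sqrt h ^+ m.+1 * (CF * 2 ^+ m.+1 * 2)))); last first.
  by rewrite sumr_const card_ord -[leLHS]mulr_natl mulrA.
apply: ler_sum => j _.
apply: (@le_trans _ _ (\sum_(k < Nmax) (Num.sqrt h ^+ m.+1 * (CF * 2 ^+ m.+1)) * k.+1%:R ^- 2)).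
  apply: ler_sum => k _; rewrite /F.
  have k0 : 0 < k.+1%:R :> R by [].
  have kh : 0 < k.+2%:R * h by rewrite mulr_gt0.
  have sk : Num.sqrt (k.+2%:R * h) <= 2 * k.+1%:R * Num.sqrt h.
    rewrite sqrtrM// ler_wpM2r ?sqrtr_ge0//.
    have k2 : k.+2%:R <= 2 * k.+1%:R :> R.
      by rewrite -natrM ler_nat mul2n -addnn addSnnS leq_addl.
    apply: le_trans k2; rewrite -[leRHS]ger0_norm// -sqrtr_sqr ler_wsqrtr//.
    by rewrite expr2 ler_peMl// ler1n.
  apply: (@le_trans _ _ (k.+1%:R ^- m.+3 * (CF * (2 * k.+1%:R * Num.sqrt h) ^+ m.+1))).
    rewrite ler_wpM2l ?invr_ge0 ?exprn_ge0//; apply: (le_trans (below_le j _ kh)).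
    rewrite ler_wpM2l ?(ltW CF0)//; apply: lerXn2r => //.
      by rewrite nnegrE sqrtr_ge0.
    by rewrite nnegrE !mulr_ge0// sqrtr_ge0.
  have -> : k.+1%:R ^+ m.+3 = k.+1%:R ^+ m.+1 * k.+1%:R ^+ 2 :> R.
    by rewrite -exprD addn2.
  rewrite !exprMn.
  have := lt0r_neq0 (exprn_gt0 m.+1 k0).
  move: (lt0r_neq0 k0); set a := k.+1%:R; set x := a ^+ m.+1 => a0 x0.
  by rewrite le_eqVlt; apply/orP; left; apply/eqP; field; rewrite x0 andbT nat1r.
rewrite -mulr_sumr [leRHS]mulrA ler_wpM2l ?sum_inv_sqr_le//.
by rewrite !mulr_ge0 ?exprn_ge0 ?sqrtr_ge0// ltW.
Qed.

Let mTf i : measurable_fun setT (T i).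
Proof. by move=> _ Y mY; rewrite setTI; exact: mT. Qed.

Let mexp b i : measurable_fun setT (fun w => expR (- b * T i w)).
Proof.
apply: measurableT_comp; first exact: measurable_expR.
exact: measurable_funM.
Qed.

(** The sign of this difference decides how a softmax weight compares with [a], so no quotient has
    to be shown measurable. *)
Let mcross b a n j : measurable_fun setT
  (fun w => expR (- b * T j w) - a * \sum_(i < n) expR (- b * T i w)).
Proof.
apply: measurable_funB => //; apply: measurable_funM => //.
by apply: measurable_sum => i.
Qed.

Let exp_sum_gt0 b n (t : nat -> R) : (0 < n)%N -> 0 < \sum_(i < n) expR (- b * t i).
Proof.
case: n => // n _; rewrite big_ord_recl ltr_pwDl ?expR_gt0//.
by apply: sumr_ge0 => i _; exact: expR_ge0.
Qed.

Lemma measurable_softmax_ge b a n j : (0 < n)%N ->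
  measurable [set w | a <= softmax b (T ^~ w) n j].
Proof.
move=> n0; rewrite (_ : [set _ | _] =
  (fun w => expR (- b * T j w) - a * \sum_(i < n) expR (- b * T i w)) @^-1` `[0, +oo[).
  by rewrite -[X in measurable X]setTI; apply: mcross => //; exact: measurable_itv.
by apply/seteqP; split=> w /=; rewrite in_itv /= andbT subr_ge0 /softmax
  ler_pdivlMr//; exact: (exp_sum_gt0 b n (T ^~ w)).
Qed.

Lemma measurable_softmax_le b a n j : (0 < n)%N ->
  measurable [set w | softmax b (T ^~ w) n j <= a].
Proof.
move=> n0; rewrite (_ : [set _ | _] =
  (fun w => expR (- b * T j w) - a * \sum_(i < n) expR (- b * T i w)) @^-1` `]-oo, 0]).
  by rewrite -[X in measurable X]setTI; apply: mcross => //; exact: measurable_itv.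
by apply/seteqP; split=> w /=; rewrite in_itv /= subr_le0 /softmax
  ler_pdivrMr//; exact: (exp_sum_gt0 b n (T ^~ w)).
Qed.

Definition spread_event (b eps : R) (n : nat) : set Omega :=
  [set w | forall j, (j < n)%N -> softmax b (T ^~ w) n j <= 1 - eps].

Lemma measurable_spread_event b eps n : (0 < n)%N ->
  measurable (spread_event b eps n).
Proof.
move=> n0; rewrite (_ : spread_event b eps n =
  \bigcap_(j in `I_n) [set w | softmax b (T ^~ w) n j <= 1 - eps])//.
by apply: fin_bigcap_measurable => [|j _]; [exact: finite_II|exact: measurable_softmax_le].
Qed.

(** With k = floor(T_i / h) < N, a T_j within h of T_i is in the k-th cell or a neighbour. *)
Lemma close_pair_eventP n N h w i j : 0 < h -> (i < n)%N -> (j < n)%N ->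
  i != j -> T i w < N%:R * h -> `|T i w - T j w| < h -> close_pair_event n N h w.
Proof.
move=> h0 ni nj ij iN ijh.
have /andP[ti0 _] := T02 i w; have /andP[tj0 _] := T02 j w.
have tih : 0 <= T i w / h by rewrite divr_ge0// ltW.
have /andP[] := truncn_itv tih.
set k := Num.trunc _; rewrite ler_pdivlMr// ltr_pdivrMr// => k1 k2.
have kN : (k < N)%N by rewrite -(ltr_nat R) -(ltr_pM2r h0); exact: le_lt_trans k1 iN.
exists i => //; exists j => //; exists k => //; rewrite (negbTE ij).
move: ijh; rewrite ltr_norml => /andP[d1 d2].
split; rewrite /= in_itv /=; first by rewrite k1 k2.
have k2' : k.+2%:R * h = k.+1%:R * h + h by rewrite -natr1; ring.
apply/andP; split; last by rewrite k2'; lra.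
move: k1; case: (k) => [|l] /= k1; first by rewrite mul0r.
have l2' : l.+1%:R * h = l%:R * h + h by rewrite -natr1; ring.
by move: k1; rewrite l2' => k1; lra.
Qed.

(** Outside the three events the hypotheses of [softmax_gap] hold; floor(2/h) terms suffice because
    T <= 2. *)
Lemma spread_event_sub b eps theta n N h : 0 < b -> 0 < h -> (0 < N)%N ->
  m.+3`!%:R / (b * h / (2 * N%:R)) ^+ m.+3 * theta < eps ->
  spread_event b eps n `<=`
    \bigcap_(i in [set` iota 0 n]) (T i @^-1` `[N%:R * h, +oo[) `|`
    close_pair_event n N h `|`
    [set w | theta <= far_sum n (Num.trunc (2 / h)) h w].
Proof.
move=> b0' h0 N0 Qeps w wB; apply: contrapT => nE.
have [i ni] : exists2 i, (i < n)%N & 1 - eps < softmax b (T ^~ w) n i.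
  apply: (@softmax_gap _ n N (Num.trunc (2 / h)) m.+2 b h eps (T ^~ w)) => //.
  - by move=> j _; have /andP[] := T02 j w.
  - apply: contrapT => nex; apply: nE; left; left => i /=.
    rewrite mem_iota /= in_itv /= andbT => ni.
    by rewrite leNgt; apply/negP => tiN; apply: nex; exists i.
  - move=> i j ni nj ij tiN; rewrite leNgt; apply/negP => tij.
    by apply: nE; left; right; apply: (close_pair_eventP n N h w i j).
  - move=> j nj; have /andP[_ tj2] := T02 j w; apply: (le_lt_trans tj2).
    have /truncn_itv/andP[_] : 0 <= 2 / h by rewrite divr_ge0// ltW.
    by rewrite ltr_pdivrMr.
  apply: le_lt_trans Qeps; rewrite ler_wpM2l//.
    by rewrite divr_ge0// exprn_ge0// divr_ge0// ?mulr_ge0// ltW.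
  by rewrite leNgt; apply/negP => yt; apply: nE; right; exact: ltW.
by rewrite ltNge => /negP; apply; exact: wB.
Qed.

Lemma spread_event_cvg0 (beta r : nat -> R) :
  (forall n, (0 < n)%N -> 0 < beta n) -> (forall n, (0 < n)%N -> 0 < r n) ->
  (forall n, (0 < n)%N -> n%:R * Num.sqrt (r n) ^+ m.+1 = 1) ->
  (forall e, 0 < e -> \forall n \near \oo, r n < e) ->
  (forall A, \forall n \near \oo, A <= beta n * r n) ->
  forall eps eta, 0 < eps -> 0 < eta ->
    \forall n \near \oo, pr P (spread_event (beta n) eps n) <= eta.
Proof.
move=> beta0 r0 nr rto0 gtooo eps eta eps0 eta0.
(* The constants X, K, N, theta, G are fixed in this order, before n. This X gives exp(-cX) <=
   1/(cX) <= eta/3. *)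
pose X := Num.max 1 (3 / (c * eta)).
have X1 : 1 <= X by rewrite /X le_max lexx.
have X0 : 0 < X by rewrite (lt_le_trans ltr01).
have cX : 3 / eta <= c * X.
  rewrite [c * X]mulrC -ler_pdivrMr// /X le_max; apply/orP; right.
  by rewrite invfM mulrA mulrAC.
pose K := 2 * X ^+ 2.
have K0 : 0 < K by rewrite mulr_gt0// exprn_gt0.
(* Once n sqrt(r)^(m+1) = 1 is inserted, [close_pair_event_le] reads D2 / sqrt N; N is chosen to
   make this at most eta/3. *)
pose D2 := CF * C * Num.sqrt 2 ^+ m * Num.sqrt 3 * (Num.sqrt K ^+ m.+1) ^+ 2.
have D20 : 0 < D2.
  by rewrite /D2 !mulr_gt0// ?exprn_gt0// ?sqrtr_gt0// exprn_gt0// sqrtr_gt0.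
pose N := (Num.trunc ((3 * D2 / eta) ^+ 2)).+1.
have N0 : 0 < N%:R :> R by [].
have NsD : D2 / Num.sqrt N%:R <= eta / 3.
  have : 3 * D2 / eta <= Num.sqrt N%:R.
    have D2e : 0 <= 3 * D2 / eta by apply: divr_ge0; [apply: mulr_ge0|]; exact: ltW.
    rewrite -(ger0_norm D2e).
    rewrite -sqrtr_sqr ler_wsqrtr//.
    by have /andP[_ /ltW] := truncn_itv (sqr_ge0 (3 * D2 / eta)).
  rewrite ler_pdivrMr// => h.
  rewrite ler_pdivrMr ?sqrtr_gt0//; lra.
(* The value of the bound in [far_sum_le], so theta = 3 D3 / eta leaves probability at most
   eta/3. *)
pose D3 := Num.sqrt (K / N%:R) ^+ m.+1 * (CF * 2 ^+ m.+1 * 2).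
have D30 : 0 < D3.
  by rewrite /D3 !mulr_gt0 ?exprn_gt0 ?sqrtr_gt0 ?divr_gt0.
pose theta := 3 * D3 / eta.
have theta0 : 0 < theta by rewrite divr_gt0// mulr_gt0.
(* Any x >= G satisfies x^(m+3) >= x > (m+3)! theta / eps; the first inequality uses G >= 1. *)
pose G := Num.max 1 (m.+3`!%:R * theta / eps + 1).
have G1 : 1 <= G by rewrite /G le_max lexx.
near=> n.
have n0 : (0 < n)%N by near: n; exact: nbhs_infty_gt.
have rn0 := r0 n n0; have bn0 := beta0 n n0.
have nrn := nr n n0.
have rb : r n < b0 / (2 * K) by near: n; apply: rto0; rewrite divr_gt0// mulr_gt0.
have rt : r n < t0 / X ^+ 2 by near: n; apply: rto0; rewrite divr_gt0// exprn_gt0.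
(* The divergence of beta r enters here: with h = K r / N, beta h / (2N) = beta r K / (2 N^2) >=
   G. *)
have rg : 2 * N%:R ^+ 2 / K * G <= beta n * r n by near: n; exact: gtooo.
pose h := K * r n / N%:R.
have h0 : 0 < h by rewrite divr_gt0// mulr_gt0.
have Nh : N%:R * h = K * r n by rewrite /h mulrC divfK// gt_eqF.
have srn0 : 0 < Num.sqrt (r n) by rewrite sqrtr_gt0.
have xG : G <= beta n * h / (2 * N%:R).
  rewrite (_ : beta n * h / (2 * N%:R) = beta n * r n * (K / (2 * N%:R ^+ 2))).
    rewrite -ler_pdivrMr ?divr_gt0 ?mulr_gt0 ?exprn_gt0//.
    by rewrite invf_div mulrC.
  by rewrite /h; field; rewrite gt_eqF.
have Qeps : m.+3`!%:R / (beta n * h / (2 * N%:R)) ^+ m.+3 * theta < eps.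
  set x := _ / (2 * _) in xG *; have x1 : 1 <= x by exact: le_trans xG.
  have x0 : 0 < x by rewrite (lt_le_trans ltr01).
  rewrite mulrAC ltr_pdivrMr ?exprn_gt0// [ltRHS]mulrC -ltr_pdivrMr//.
  apply: (@lt_le_trans _ _ x); last exact: ler_eXnr.
  by apply: lt_le_trans xG; rewrite /G lt_max ltrDl ltr01 orbT.
have mE1 : measurable (\bigcap_(i in [set` iota 0 n]) (T i @^-1` `[N%:R * h, +oo[)).
  by apply: fin_bigcap_measurable.
have mE2 := measurable_close_pair_event n N h.
have mE3 := measurable_far_sum_ge n (Num.trunc (2 / h)) h theta.
have := pr_setU3 P _ _ _ _ (measurable_spread_event (beta n) eps n n0) mE1 mE2 mE3
  (spread_event_sub (beta n) eps theta n N h bn0 h0 isT Qeps).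
move=> /le_trans; apply.
rewrite [leRHS](_ : _ = eta / 3 + eta / 3 + eta / 3); last by field.
apply: lerD; first apply: lerD.
(* Here Nh = K r = 2t with t = X^2 r, so n sqrt(t)^(m+1) = X^(m+1) >= X. *)
- rewrite Nh /K -mulrA; apply: le_trans.
    apply: all_above_le; first by rewrite mulr_gt0// exprn_gt0.
    by rewrite mulrC -ler_pdivlMr ?exprn_gt0// ltW.
  rewrite sqrtrM ?sqr_ge0// sqrtr_sqr ger0_norm ?(ltW X0)// exprMn.
  rewrite (_ : n%:R * _ = c * X ^+ m.+1 * (n%:R * Num.sqrt (r n) ^+ m.+1)); last by ring.
  rewrite nrn mulr1; apply: (@le_trans _ _ (expR (- (c * X)))).
    by rewrite ler_expR lerN2 ler_wpM2l ?(ltW c0)//; exact: ler_eXnr.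
  apply: le_trans (expRN_le_pow 0 _ (mulr_gt0 c0 X0)) _.
  by rewrite expr1 div1r -[leRHS]invf_div lef_pV2 ?posrE ?divr_gt0 ?mulr_gt0.
- apply: le_trans.
    apply: close_pair_event_le => //.
    rewrite Nh mulrA mulrC -ler_pdivlMr ?mulr_gt0//; exact: ltW.
  apply: le_trans NsD; rewrite Nh /h.
  have e1 : Num.sqrt (K * r n) = Num.sqrt K * Num.sqrt (r n).
    by rewrite sqrtrM// ltW.
  have e2 : Num.sqrt (2 * (K * r n)) = Num.sqrt 2 * (Num.sqrt K * Num.sqrt (r n)).
    by rewrite sqrtrM// e1.
  have e3 : Num.sqrt (3 * (K * r n / N%:R)) =
      Num.sqrt 3 * (Num.sqrt K * Num.sqrt (r n) / Num.sqrt N%:R).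
    rewrite sqrtrM// (@sqrtrM _ (K * r n)) ?e1 ?sqrtrV ?(ltW N0)//.
    by apply: mulr_ge0; exact: ltW.
  rewrite e1 e2 e3 [leLHS](_ : _ = (n%:R * Num.sqrt (r n) ^+ m.+1) ^+ 2 *
    (D2 / Num.sqrt N%:R)); first by rewrite nrn expr1n mul1r.
  rewrite /D2; move: (Num.sqrt K) (Num.sqrt (r n)) (Num.sqrt N%:R)^-1 => u v z.
  by rewrite !exprMn !exprS; ring.
rewrite -(ler_pM2l theta0); apply: (le_trans (far_sum_le _ _ _ _ h0 (ltW theta0))).
rewrite /theta [leRHS](_ : _ = D3); last by field; rewrite gt_eqF.
rewrite /D3 mulrA (_ : h = K / N%:R * r n); last by rewrite /h mulrAC.
rewrite sqrtrM ?divr_ge0 ?(ltW K0)// exprMn.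
rewrite [leLHS](_ : _ = (n%:R * Num.sqrt (r n) ^+ m.+1) *
  (Num.sqrt (K / N%:R) ^+ m.+1 * (CF * 2 ^+ m.+1 * 2))); last by ring.
by rewrite nrn mul1r -mulrA.
Unshelve. all: by end_near.
Qed.

End SoftmaxConcentration.

(** * Order statistics of the attention weights *)

Section OrderStatistics.
Context {R : realType}.
Implicit Types (s : seq R) (a : R).
Local Notation geR := (fun a b : R => b <= a).

Lemma ge_sort_sorted s : sorted geR (sort geR s).
Proof. by apply: sort_sorted => a b; exact: le_total. Qed.

(** Positivity of [a] handles indices past the end: the default value 0 then fails the test, as the
    count does. *)
Lemma nth_sorted_ge s k a : 0 < a -> sorted geR s ->
  (a <= nth 0 s k) = (k < count (fun y => (a <= y)%R) s)%N.
Proof.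
move=> a0; have tr : transitive geR by move=> y x z /= yx zy; exact: le_trans yx.
elim: s k => [|x s IH] k; first by rewrite nth_nil leNgt a0.
rewrite /= (path_sortedE tr) => /andP[/allP xs /IH{}IH].
have [ax|xa] := leP a x; first by case: k => [|k] /=; rewrite ?ax// IH.
have c0 : count (fun y => (a <= y)%R) s = 0%N.
  apply/eqP; rewrite -leqn0 leqNgt -has_count; apply/hasPn => y /xs yx.
  by rewrite -ltNge (le_lt_trans yx).
by case: k => [|k] /=; [rewrite leNgt xa c0 | rewrite IH c0].
Qed.

Lemma nth_sort_ge s k a : 0 < a ->
  (a <= nth 0 (sort geR s) k) = (k < count (fun y => (a <= y)%R) s)%N.
Proof.
move=> a0; rewrite nth_sorted_ge// ?ge_sort_sorted//; congr (_ < _)%N.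
by apply/permP; rewrite perm_sort.
Qed.

(** Otherwise the entries satisfying [p] would all equal [j], which occurs at most once. *)
Lemma count_ge2_other (I : eqType) (p : pred I) (s : seq I) (j : I) : uniq s ->
  (1 < count p s)%N -> exists2 l, l \in s & (l != j) && p l.
Proof.
move=> us c2; apply/hasP; apply: contraTT c2 => /hasPn h; rewrite -leqNgt.
apply: leq_trans (_ : count_mem j s <= 1)%N; last by rewrite count_uniq_mem// leq_b1.
rewrite -!size_filter; apply: uniq_leq_size; first exact: filter_uniq.
move=> l; rewrite !mem_filter => /andP[pl ls]; rewrite ls andbT.
by have := h l ls; rewrite pl andbT negbK.
Qed.

End OrderStatistics.

(** * Measurability of counting events *)

Section CountEvents.
Context {dO : measure_display} {Omega : measurableType dO}.

Lemma measurable_count_ge (p : nat -> Omega -> bool) (s : seq nat) k :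
  (forall j, measurable [set w | p j w]) ->
  measurable [set w | (k <= count (fun j => p j w) s)%N].
Proof.
move=> mp; elim: s k => [|j s IH] k.
  case: k => [|k]; last by rewrite (_ : [set _ | _] = set0)//; apply/seteqP; split.
  by rewrite (_ : [set _ | _] = setT)//; apply/seteqP; split.
rewrite (_ : [set _ | _] = ([set w | p j w] `&` [set w | (k.-1 <= count (fun j => p j w) s)%N])
  `|` [set w | (k <= count (fun j => p j w) s)%N]).
  by apply: measurableU => //; exact: measurableI.
apply/seteqP; split=> w /=; case: (p j w) => /=; rewrite ?add1n ?add0n.
- by case: k => [|k] /=; [right|rewrite ltnS; left].
- by right.
- by case: k => [|k] //=; rewrite ltnS => -[[]//|/ltnW].
- by case=> // -[].
Qed.

End CountEvents.

(** * Ranked attention weights and the spread event *)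

Section AttentionOrder.
Context {R : realType} {d : nat} {dO : measure_display} {Omega : measurableType dO}.
Variables (P : probability Omega R) (beta : nat -> R) (q : 'rV[R]_d).
Variable x : nat -> Omega -> 'rV[R]_d.
Let A n j w := attn beta q x n j w.

Lemma attn_ge0 n j w : 0 <= A n j w.
Proof.
by rewrite divr_ge0 ?expR_ge0//; apply: sumr_ge0 => i _; exact: expR_ge0.
Qed.

Lemma attn_sum n w : (0 < n)%N -> \sum_(j < n) A n j w = 1.
Proof.
move=> n0; rewrite /A /attn -big_distrl /= divff// /Zn.
case: n n0 => // n _; rewrite big_ord_recl gt_eqF// ltr_pwDl ?expR_gt0//.
by apply: sumr_ge0 => i _; exact: expR_ge0.
Qed.

Lemma attn_add_le1 n i j w : (i < n)%N -> (j < n)%N -> i != j ->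
  A n i w + A n j w <= 1.
Proof.
move=> ni nj ij; rewrite -(attn_sum n w (leq_ltn_trans (leq0n _) ni)).
rewrite (bigD1 (Ordinal ni))//= (bigD1 (Ordinal nj))/=; last by rewrite eq_sym.
by rewrite addrA lerDl; apply: sumr_ge0 => l _; exact: attn_ge0.
Qed.

Lemma attn_le1 n j w : (j < n)%N -> A n j w <= 1.
Proof.
move=> nj; rewrite -(attn_sum n w (leq_ltn_trans (leq0n _) nj)).
rewrite (bigD1 (Ordinal nj))//= lerDl.
by apply: sumr_ge0 => l _; exact: attn_ge0.
Qed.

Lemma attn_ord_ge n i a w : 0 < a ->
  (a <= attn_ord beta q x n i.+1 w) =
  (i < count (fun j => (a <= A n j w)%R) (iota 0 n))%N.
Proof. by move=> a0; rewrite /attn_ord /= nth_sort_ge// count_map. Qed.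

Lemma attn_ord_ge0 n i w : 0 <= attn_ord beta q x n i w.
Proof.
rewrite /attn_ord; case: eqP => // _.
set s := sort _ _; have [si|si] := ltnP i.-1 (size s); last by rewrite nth_default.
have /mapP[j _ ->] : nth 0 s i.-1 \in [seq attn beta q x n j w | j <- iota 0 n].
  by rewrite -(mem_sort (fun a b : R => b <= a)) mem_nth.
exact: attn_ge0.
Qed.

Let spread eps n := [set w | forall j, (j < n)%N -> A n j w <= 1 - eps].

(** The first order statistic is the maximum of the weights and is at most 1, so it misses 1 by eps
    exactly when every weight does. *)
Lemma attn_ord1_far n eps : (0 < n)%N -> 0 < eps ->
  [set w | eps <= `|attn_ord beta q x n 1 w - 1|] = spread eps n.
Proof.
move=> n0 e0.
have max_le w a : 0 < a ->
    (a <= attn_ord beta q x n 1 w) <-> exists2 j, (j < n)%N & a <= A n j w.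
  move=> a0; rewrite attn_ord_ge// -has_count; split.
    by move=> /hasP[j]; rewrite mem_iota => /andP[_ jn] aj; exists j.
  by move=> [j jn aj]; apply/hasP; exists j; rewrite ?mem_iota.
have ord_le1 w : attn_ord beta q x n 1 w <= 1.
  rewrite leNgt; apply/negP => h.
  have /(max_le w _ _)[] := lexx (attn_ord beta q x n 1 w); first exact: lt_trans h.
  by move=> j jn /(lt_le_trans h); rewrite ltNge attn_le1.
apply/seteqP; split=> w /=; rewrite ler0_norm ?subr_le0// opprB.
  (* [max_le] needs a positive level, so a nonpositive one is treated apart. *)
  move=> h j jn; have [Aj|Aj] := leP (A n j w) 0.
    apply: le_trans Aj _; apply: le_trans (attn_ord_ge0 n 1 w) _; lra.
  suff : A n j w <= attn_ord beta q x n 1 w by lra.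
  by apply/max_le => //; exists j.
move=> h; suff : attn_ord beta q x n 1 w <= 1 - eps by lra.
have [//|Ap] := leP (attn_ord beta q x n 1 w) 0.
  by move=> /le_trans; apply; apply: le_trans (h 0%N n0); exact: attn_ge0.
have /(max_le w _ Ap)[j jn /le_trans] := lexx (attn_ord beta q x n 1 w).
by apply; exact: h.
Qed.

(** At least two weights reach eps, so each j has a competitor l of weight at least eps, and A_j +
    A_l <= 1. The same event thus controls all lower ranks. *)
Lemma attn_ord_ge_spread n i eps : (0 < i)%N -> 0 < eps ->
  [set w | eps <= `|attn_ord beta q x n i.+1 w - 0|] `<=` spread eps n.
Proof.
move=> i0 e0 w /=; rewrite subr0 ger0_norm ?attn_ord_ge0// attn_ord_ge// => ci j jn.
have [l] := count_ge2_other _ _ _ j (iota_uniq 0 n) (leq_ltn_trans i0 ci).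
rewrite mem_iota => /andP[_ ln] /andP[lj el].
have := attn_add_le1 n j l w jn ln; rewrite eq_sym lj => /(_ isT); lra.
Qed.

Lemma measurable_attn_ord_ge n i eps : 0 < eps ->
  (forall j, measurable [set w | eps <= A n j w]) ->
  measurable [set w | eps <= `|attn_ord beta q x n i.+1 w - 0|].
Proof.
move=> e0 mA; rewrite (_ : [set _ | _] =
  [set w | (i.+1 <= count (fun j => (eps <= A n j w)%R) (iota 0 n))%N]).
  exact: measurable_count_ge.
by apply/seteqP; split=> w /=; rewrite subr0 ger0_norm ?attn_ord_ge0// attn_ord_ge.
Qed.

Lemma cvg_in_prob_pr (Y : nat -> Omega -> R) (y : R) :
  (forall eps, 0 < eps -> forall eta, 0 < eta -> \forall n \near \oo,
    pr P [set w | eps <= `|Y n w - y|] <= eta) ->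
  (forall eps, 0 < eps -> forall n, (0 < n)%N ->
    measurable [set w | eps <= `|Y n w - y|]) ->
  cvg_in_prob P Y y.
Proof.
move=> prY mY eps e0; apply/fine_cvgP; split.
  near=> n; rewrite fin_num_measure//; apply: mY => //.
  by near: n; exact: nbhs_infty_gt.
apply/cvgrPdist_le => eta eta0; near=> n.
rewrite sub0r normrN /= ger0_norm ?fine_ge0//.
by near: n; exact: prY.
Unshelve. all: by end_near.
Qed.

End AttentionOrder.

(** * Borel preimages under [Tval q] *)

Section BorelTval.
Context {R : realType} {d : nat}.
Implicit Types q : 'rV[R]_d.

Lemma continuous_Tval q : continuous (Tval q).
Proof.
have cont_inner : continuous (inner q).
  apply: (@continuous_big _ _ +%R 0 xpredT) => [|i _ v]; first exact: add_continuous.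
  by apply: continuousM; [exact: cst_continuous|exact: coord_continuous].
by move=> v; apply: continuousB; [exact: cst_continuous|exact: cont_inner].
Qed.

Lemma borel_vec_Tval q (B : set R) : measurable B -> borel_vec (Tval q @^-1` B).
Proof.
have [s0 sC sU] := smallest_sigma_algebra setT [set A : set 'rV[R]_d | open A].
move=> mB; have {}mB : (@ocitv R).-sigma.-measurable B by exact: mB.
rewrite RGenOInfty.measurableE in mB.
(* Good sets: those with Borel preimage form a sigma-algebra containing the open rays ]a, +oo[,
   which generate. *)
apply: (mB [set B' | borel_vec (Tval q @^-1` B')]); split.
  split=> [|X bX|F bF]; first by rewrite /= preimage_set0.
  - exact: (sC _ bX).
  - by rewrite /= preimage_bigcup; exact: sU.
move=> _ [a ->]; apply: sub_sigma_algebra => /=.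
apply: open_comp; first by move=> v _; exact: continuous_Tval.
exact: interval_open.
Qed.

End BorelTval.

(** * The scale n^(-alpha) *)

Section Scaling.
Context {R : realType}.

Lemma sqrt_powR_scale (m n : nat) :
  Num.sqrt (n%:R `^ (- (2 / m.+1%:R)) : R) ^+ m.+1 = n%:R^-1.
Proof.
rewrite -powR12_sqrt ?powR_ge0// -powR_mulrn ?powR_ge0// -!powRrM.
by rewrite (_ : _ * (_ * _) = -1) ?powR_inv1//; field; rewrite nat1r.
Qed.

Lemma powR_scale_lt (m : nat) (e : R) : 0 < e ->
  \forall n \near \oo, n%:R `^ (- (2 / m.+1%:R)) < e.
Proof.
move=> e0; near=> n.
have n0 : (0 < n)%N by near: n; exact: nbhs_infty_gt.
have se : 0 < Num.sqrt e by rewrite sqrtr_gt0.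
rewrite -ltr_sqrt// -(@ltr_pXn2r _ m.+1)// ?nnegrE ?sqrtr_ge0//.
rewrite sqrt_powR_scale -[ltRHS]invrK ltf_pV2 ?posrE ?ltr0n ?invr_gt0 ?exprn_gt0//.
by near: n; exact: nbhs_infty_gtr.
Unshelve. all: by end_near.
Qed.

End Scaling.

Theorem mainTheorem1 (R : realType) (d : nat) (dO : measure_display)
  (Omega : measurableType dO) (P : probability Omega R)
  (q : 'rV[R]_d) (rho : 'rV[R]_d -> R)
  (x : nat -> Omega -> 'rV[R]_d) (beta : nat -> R) :
  (2 <= d)%N ->
  sphere d q ->
  (* rho is a C^2 probability density on the sphere with rho(q) > 0 *)
  (forall v, sphere d v -> 0 <= rho v) ->
  sphere_int rho (sphere d) = 1%E ->
  C2_on_sphere rho ->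
  0 < rho q ->
  (* x_1, x_2, ... are i.i.d. random vectors on the sphere with law rho dsigma *)
  (forall i w, sphere d (x i w)) ->
  (forall i B, borel_vec B -> measurable (x i @^-1` B)) ->
  (forall i B, borel_vec B ->
     P (x i @^-1` B) = sphere_int rho (B `&` sphere d)) ->
  mutually_independent P x ->
  (* positive temperatures with beta_n n^{-alpha} -> oo, alpha = 2/(d-1) *)
  (forall n, (0 < n)%N -> 0 < beta n) ->
  (fun n => beta n * n%:R `^ (- (2 / (d.-1)%:R))) @ \oo --> +oo ->
  cvg_in_prob P (fun n w => attn_ord beta q x n 1 w) 1 /\
  (forall i, (2 <= i)%N -> cvg_in_prob P (fun n w => attn_ord beta q x n i w) 0).
Proof.
move=> d2 qS rho0 rhoint rhoC2 rhoq xS mx lawx indx beta0 gbeta.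
case: d d2 q rho x qS rho0 rhoint rhoC2 rhoq xS mx lawx indx gbeta => [//|[//|m]] _.
move=> q rho x qS rho0 _ rhoC2 rhoq xS mx lawx indx gbeta.
have qN0 : q != 0.
  apply/eqP => q0; move: qS; rewrite /sphere /= q0 /inner big1; last first.
    by move=> i _; rewrite mxE mul0r.
  by move=> /eqP; rewrite eq_sym oner_eq0.
have rho_cont : {for q, continuous (fun v => rho (normalize v))}.
  by have [_ [h _]] := rhoC2; exact: h.
have [C [b0 [C0 b00 cell]]] := sphere_int_cell_le q rho qS rho0 rho_cont rhoq.
have [c [t0 [c0 t00 cap]]] := sphere_int_cap_ge q rho qS rho0 rho_cont rhoq.
pose T i w := Tval q (x i w).
have bT B : measurable B -> borel_vec (Tval q @^-1` B) by exact: borel_vec_Tval.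
have mT i B : measurable B -> measurable (T i @^-1` B).
  by move=> mB; exact: (mx i (Tval q @^-1` B) (bT B mB)).
have T02 i w : 0 <= T i w <= 2.
  by rewrite Tval_ge0 ?Tval_le2//; exact: xS.
have mTi i (I : interval R) : measurable (T i @^-1` [set` I]).
  by apply: mT; exact: measurable_itv.
have cell_le i a b : 0 <= a -> a <= b -> 0 < b -> b <= b0 ->
    pr P (T i @^-1` `[a, b[) <= C * Num.sqrt b ^+ m * Num.sqrt (b - a).
  move=> a0 ab bp bb; rewrite -lee_fin -prE//.
  rewrite (lawx i (Tval q @^-1` `[a, b[)); last by apply: bT; exact: measurable_itv.
  apply: cell => // v [] /=; rewrite in_itv /= => /andP[-> /ltW ->] _.
  by [].
(* The factor 2 fits the closed cap T <= t into a half-open interval. *)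
have cap_ge i t : 0 < t -> t <= t0 ->
    c * Num.sqrt t ^+ m.+1 <= pr P (T i @^-1` `[0, 2 * t[).
  move=> tp tt; rewrite -lee_fin -prE//.
  rewrite (lawx i (Tval q @^-1` `[0, 2 * t[)); last by apply: bT; exact: measurable_itv.
  apply: (cap _ _ tp tt) => v [vS] /= vt; split=> //=.
  by rewrite in_itv /= Tval_ge0//=; lra.
have indT (s : seq nat) (B : nat -> set R) : uniq s ->
    (forall i, measurable (B i)) ->
    P (\bigcap_(i in [set` s]) (T i @^-1` B i)) =
      (\prod_(i <- s) P (T i @^-1` B i))%E.
  by move=> us mB; apply: (indx s (fun i => Tval q @^-1` B i)) => // i; exact: bT.
pose r n : R := n%:R `^ (- (2 / m.+1%:R)).
have r0 n : (0 < n)%N -> 0 < r n by move=> n0; rewrite powR_gt0// ltr0n.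
have nr n : (0 < n)%N -> n%:R * Num.sqrt (r n) ^+ m.+1 = 1.
  by move=> n0; rewrite sqrt_powR_scale divff// pnatr_eq0 -lt0n.
have spread0 := spread_event_cvg0 P T m C b0 c t0 C0 b00 c0 t00 mT T02 cell_le cap_ge indT
  beta r beta0 r0 nr (@powR_scale_lt R m) (proj1 (cvgryPge _) gbeta).
have mspread eps n : (0 < n)%N -> measurable (spread_event T (beta n) eps n).
  exact: (measurable_spread_event T mT).
(* Both limits reduce to [spread0]: [softmax] at [T ^~ w] unfolds to [attn], so [spread_event] is
   the event of the order-statistics lemmas. *)
split=> [|[|[|i]] // _]; apply: cvg_in_prob_pr => eps e0.
- move=> eta eta0; near=> n.
  rewrite attn_ord1_far//; last by near: n; exact: nbhs_infty_gt.
  by near: n; exact: spread0.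
- by move=> n n0; rewrite attn_ord1_far//; exact: mspread.
- move=> eta eta0; near=> n.
  have n0 : (0 < n)%N by near: n; exact: nbhs_infty_gt.
  apply: (@le_trans _ _ (pr P (spread_event T (beta n) eps n))).
    apply: le_pr; last exact: attn_ord_ge_spread.
      apply: measurable_attn_ord_ge => // j.
      exact: (measurable_softmax_ge T mT).
    exact: mspread.
  by near: n; exact: spread0.
- move=> n n0; apply: measurable_attn_ord_ge => // j.
  exact: (measurable_softmax_ge T mT).
Unshelve. all: by end_near.
Qed.
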